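(* Let $0<x<1$ and $t>0$. Let $\phi=\{\phi(y):0\le y\le1\}$ be a Gaussian process in $L^2(\Omega\times[0,1])$ and let $\alpha^2$ be a positive random variable. For $n\ge1$ let $A_n(\omega)=2\int_0^1\phi(y)(\omega)\sin(n\pi y)\,dy$. Suppose that, for every $N\ge1$, $\alpha^2$ and $(A_1,\ldots,A_N)$ are independent and absolutely continuous. Let $\Sigma_N$ be the covariance matrix of $(A_1,\ldots,A_N)$, and assume that there is a constant $C$ such that $(\Sigma_N^{-1})_{11}\le C$ for all $N\ge1$. Assume also that $\sum_{n=m}^\infty\|e^{-(n^2-2)\pi^2\alpha^2t}\|_{L^1(\Omega)}<\infty$ for certain $m\in\mathbb N$. Then the density of $u_N(x,t)(\omega)=\sum_{n=1}^NA_n(\omega)e^{-n^2\pi^2\alpha^2(\omega)t}\sin(n\pi x)$, namely $$f_{u_N(x,t)}(u)=\int_{\mathbb R^N}f_{(A_1,\ldots,A_N)}\left(\frac{e^{\pi^2\alpha^2t}}{\sin(\pi x)}\left\{u-\sum_{n=2}^Na_ne^{-n^2\pi^2\alpha^2t}\sin(n\pi x)\right\},a_2,\ldots,a_N\right)f_{\alpha^2}(\alpha^2)\,\frac{e^{\pi^2\alpha^2t}}{\sin(\pi x)}\,da_2\cdots da_N\,d\alpha^2,$$ converges in $L^\infty(\mathbb R)$, as $N\to\infty$, to a density of the random variable $$u(x,t)(\omega)=\sum_{n=1}^\infty A_n(\omega)e^{-n^2\pi^2\alpha^2(\omega)t}\sin(n\pi x).$$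
   Context: All random objects live on a complete probability space $(\Omega,\mathcal F,\mathbb P)$. $L^2(\Omega\times[0,1])$ is the space of measurable $f$ on $\Omega\times[0,1]$ with $\mathbb E[\int_0^1|f(x)|^2dx]<\infty$; integrals defining $A_n$ are Lebesgue integrals for fixed $\omega$. $f_X$ denotes the probability density function of an absolutely continuous random vector $X$ (absolutely continuous with respect to Lebesgue measure). The symbol $\alpha^2$ denotes the random variable and, inside integrals, also the real integration variable of its density $f_{\alpha^2}$. For $N=1$ the integral is only over $\alpha^2$. Convergence in $L^\infty(\mathbb R)$ means that the $L^\infty(\mathbb R)$-norm of the difference tends to $0$. *)

(* Defs.v *)
From HB Require Import structures.
From mathcomp Require Import all_boot all_order all_algebra.
From mathcomp Require Import all_classical all_reals all_analysis measurable_realfun.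

Set Implicit Arguments.
Unset Strict Implicit.
Unset Printing Implicit Defensive.
Import Order.TTheory GRing.Theory Num.Theory.
Import numFieldNormedType.Exports.

Local Open Scope classical_set_scope.
Local Open Scope ring_scope.

(* Lebesgue measure on R^n, on the product sigma-algebra of [n.-tuple R]:
   the Dirac mass on R^0, then the image of a product along (x, v) |-> x :: v *)
Fixpoint lebesgue_tuple (R : realType) (n : nat) :
    set (n.-tuple R) -> \bar R :=
  match n with
  | 0 => \d_([tuple] : 0.-tuple R)
  | m.+1 => pushforward (lebesgue_measure \x @lebesgue_tuple R m)%E
              (fun z : R * m.-tuple R => [tuple of z.1 :: z.2])
  end.
Arguments lebesgue_tuple : clear implicits.

Section lebesgue_tuple_measure.
Context (R : realType).
Local Open Scope ereal_scope.

Lemma measurable_tuple_cons (m : nat) :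
  measurable_fun [set: (measurableTypeR R * m.-tuple R)%type]
    (fun z : R * m.-tuple R => [tuple of z.1 :: z.2]).
Proof.
exact: (@measurable_cons _ _ (measurableTypeR R * m.-tuple R)%type R).
Qed.

Lemma lebesgue_tuple_sigma_finite_measure (n : nat) :
  exists mu : {sigma_finite_measure set (n.-tuple R) -> \bar R},
    forall A, mu A = lebesgue_tuple R n A.
Proof.
elim: n => [|m [mu muE]].
  by exists (\d_([tuple] : 0.-tuple R)).
have eqmu : lebesgue_tuple R m = mu by apply/funext => A; rewrite muE.
pose cons_ := fun z : R * m.-tuple R => [tuple of z.1 :: z.2].
pose prod : {measure set (measurableTypeR R * m.-tuple R)%type -> \bar R} :=
  (lebesgue_measure \x mu)%E.
have eqE : lebesgue_tuple R m.+1 = pushforward prod cons_.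
  by rewrite /= eqmu.
have sfp : sigma_finite setT (pushforward prod cons_).
  have /sigma_finiteP[F [TF ndF mF]] :=
    sigma_finiteT (@lebesgue_measure R).
  have /sigma_finiteP[G [TG ndG mG]] := sigma_finiteT mu.
  exists (fun i => (fun t : m.+1.-tuple R => tnth t ord0) @^-1` F i `&`
                   (fun t : m.+1.-tuple R => [tuple of behead t]) @^-1` G i).
    apply/esym; rewrite -subTset => t _.
    have [i _ Fi] : (\bigcup_i F i) (tnth t ord0) by rewrite -TF.
    have [j _ Gj] : (\bigcup_i G i) [tuple of behead t] by rewrite -TG.
    exists (maxn i j) => //; split.
      by move: Fi => /=; move: (tnth _ _); exact/subsetPset/ndF/leq_maxl.
    by move: Gj => /=; move: [tuple of _]; exact/subsetPset/ndG/leq_maxr.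
  move=> i; have [mFi Fi] := mF i; have [mGi Gi] := mG i; split.
    apply: measurableI.
      rewrite -[X in measurable X]setTI.
      exact: (measurable_tnth ord0 measurableT mFi).
    rewrite -[X in measurable X]setTI.
    exact: (@measurable_behead _ _ m measurableT _ mGi).
  rewrite /pushforward (_ : cons_ @^-1` _ = F i `*` G i).
    by rewrite /prod/= product_measure1E// lte_mul_pinfty// ge0_fin_numE.
  apply/seteqP; split => -[r v] /= [Fr Gv]; split => //=.
    by move: Gv; congr (G i _); exact/val_inj.
  by move: Gv; congr (G i _); exact/val_inj.
pose pushf := (pushforward prod cons_ :
  {measure set (m.+1.-tuple R) -> \bar R}).
pose msr := pushf (@measurable_tuple_cons m).
pose sf : {sigma_finite_measure set (m.+1.-tuple R) -> \bar R} :=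
  HB.pack (Measure.sort msr)
    (Measure_isSigmaFinite.Build _ _ _ (Measure.sort msr) sfp).
by exists sf => A; rewrite eqE.
Qed.

Let lebesgue_tuple0 n : lebesgue_tuple R n set0 = 0.
Proof.
by have [mu <-] := lebesgue_tuple_sigma_finite_measure n; exact: measure0.
Qed.

Let lebesgue_tuple_ge0 n A : 0 <= lebesgue_tuple R n A.
Proof.
by have [mu <-] := lebesgue_tuple_sigma_finite_measure n; exact: measure_ge0.
Qed.

Let lebesgue_tuple_sigma_additive n :
  semi_sigma_additive (lebesgue_tuple R n).
Proof.
have [mu muE] := lebesgue_tuple_sigma_finite_measure n.
rewrite (_ : lebesgue_tuple R n = mu); last by apply/funext => A; rewrite muE.
exact: measure_semi_sigma_additive.
Qed.

HB.instance Definition _ n := isMeasure.Build _ _ _ (lebesgue_tuple R n)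
  (lebesgue_tuple0 n) (@lebesgue_tuple_ge0 n)
  (@lebesgue_tuple_sigma_additive n).

Let lebesgue_tuple_sigma_finite n :
  sigma_finite setT (lebesgue_tuple R n).
Proof.
have [mu muE] := lebesgue_tuple_sigma_finite_measure n.
rewrite (_ : lebesgue_tuple R n = mu); last by apply/funext => A; rewrite muE.
exact: sigma_finiteT.
Qed.

HB.instance Definition _ n := Measure_isSigmaFinite.Build _ _ _
  (lebesgue_tuple R n) (@lebesgue_tuple_sigma_finite n).

End lebesgue_tuple_measure.

Section probability_notions.
Context d (Omega : measurableType d) (R : realType) (P : probability Omega R).

(* [f] is a version of the Radon-Nikodym density of the law of [X] *)
Definition is_density d' (T : measurableType d') (mu : set T -> \bar R)
    (X : Omega -> T) (f : T -> \bar R) : Prop :=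
  [/\ measurable_fun [set: Omega] X, measurable_fun [set: T] f, forall x, (0 <= f x)%E &
      forall B, measurable B -> P (X @^-1` B) = (\int[mu]_(x in B) f x)%E].

Definition independent_rv d1 d2 (T1 : measurableType d1)
    (T2 : measurableType d2) (X : Omega -> T1) (Y : Omega -> T2) : Prop :=
  forall A B, measurable A -> measurable B ->
    P (X @^-1` A `&` Y @^-1` B) = (P (X @^-1` A) * P (Y @^-1` B))%E.

(* The case s = 0 is split off because [normal_prob m 0] is the uniform
   distribution on [0, 1] rather than a point mass. *)
Definition gaussian_rv (X : Omega -> R) : Prop :=
  measurable_fun setT X /\
  exists m s : R, forall B, measurable B ->
    P (X @^-1` B) = if s == 0 then \d_m B else normal_prob m s B.

(* Every finite-dimensional marginal is a (possibly degenerate, not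
   necessarily centred) Gaussian vector, i.e. all its linear combinations
   are Gaussian. *)
Definition gaussian_process (D : set R) (phi : Omega -> R -> R) : Prop :=
  forall (k : nat) (y : 'I_k -> R) (c : 'I_k -> R),
    (forall i, D (y i)) ->
    gaussian_rv (fun w => \sum_(i < k) c i * phi w (y i)).

Definition L2_process (D : set R) (phi : Omega -> R -> R) : Prop :=
  measurable_fun (setT `*` D) (fun z : Omega * R => phi z.1 z.2) /\
  (\int[P]_w \int[lebesgue_measure]_(y in D) ((phi w y) ^+ 2)%:E < +oo)%E.

Definition covariance_mx N (X : 'I_N -> Omega -> R) : 'M[R]_N :=
  \matrix_(i, j) fine (covariance P (X i) (X j)).

End probability_notions.

Section random_heat_equation.
Context d (Omega : measurableType d) (R : realType).
Implicit Types (phi : Omega -> R -> R) (x t : R).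

Definition fourier_coef phi (n : nat) (w : Omega) : R :=
  2 * \int[lebesgue_measure]_(y in `[0, 1]%classic)
        (phi w y * sin (n%:R * pi * y)).

(* (A_1, ..., A_N): position [i : 'I_N] carries A_(i+1) *)
Definition fourier_vec phi (N : nat) (w : Omega) : N.-tuple R :=
  [tuple fourier_coef phi i.+1 w | i < N].

Definition heat_decay (n : nat) (a t : R) : R :=
  expR (- (n%:R ^+ 2 * pi ^+ 2 * a * t)).

Definition heat_partial phi (alpha2 : Omega -> R) x t (N : nat) (w : Omega) : R :=
  \sum_(1 <= n < N.+1)
    fourier_coef phi n w * heat_decay n (alpha2 w) t * sin (n%:R * pi * x).

Definition heat_sol phi (alpha2 : Omega -> R) x t (w : Omega) : R :=
  lim (heat_partial phi alpha2 x t N w @[N --> \oo]).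

End random_heat_equation.

(* The density formula for u_N with N = n + 1, given the densities [fA] of
   (A_1, ..., A_(n+1)) and [fa] of alpha^2. The integration variable is
   z = ((a_2, ..., a_(n+1)), alpha^2); position [i : 'I_n] of z.1 carries
   a_(i+2). The value may be +oo on a null set of u. *)
Definition heat_density (R : realType) (n : nat) (fA : n.+1.-tuple R -> R)
    (fa : R -> R) (x t : R) (u : R) : \bar R :=
  (\int[lebesgue_tuple R n \x lebesgue_measure]_z
    (let jac := (expR (pi ^+ 2 * z.2 * t) / sin (pi * x))%R in
     let a1 := (jac * (u - \sum_(i < n)
       tnth z.1 i * heat_decay i.+2 z.2 t * sin (i.+2%:R * pi * x)))%R in
     (fA [tuple of a1 :: z.1] * fa z.2 * jac)%:E))%E.

(* Main.v *)
(* Conditionally on alpha^2 = a, the variable u_N(x,t) is the linear combination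
   S_N(a) = \sum_n c_n(a) A_n with c_n(a) = e^{-n^2 pi^2 a t} sin(n pi x). It is a
   Gaussian variable, being the integral of phi against a bounded function, hence
   an L^2 limit of linear combinations of sampled values of phi. So another version
   of the density of u_N is the mixture E[normal_pdf(mean S_N(a), sd S_N(a))] at
   a = alpha^2. The bound (Sigma_N^{-1})_{11} <= C gives by Cauchy-Schwarz
   Var S_N(a) >= c_1(a)^2 / C uniformly in N, while mean and standard deviation of
   S_N(a) move by O(|c_{N+1}(a)|) at each step. Since (m, s) |-> normal_pdf m s u is
   Lipschitz on s >= c with constant of order c^{-2}, consecutive mixtures differ
   uniformly by O(E[e^{-((N+1)^2 - 2) pi^2 alpha^2 t}]), which is summable. A sequence
   of densities that is Cauchy in L^oo, along random variables converging almost
   surely, converges to a density of the limit. *)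
Require Import Defs.
From HB Require Import structures.
From mathcomp Require Import all_boot all_order all_algebra.
From mathcomp Require Import all_classical all_reals all_analysis measurable_realfun.
From mathcomp Require Import ring lra.

Set Implicit Arguments.
Unset Strict Implicit.
Unset Printing Implicit Defensive.
Import Order.TTheory GRing.Theory Num.Theory.
Import numFieldNormedType.Exports.

Local Open Scope classical_set_scope.
Local Open Scope ring_scope.

(** * Densities and their uniform limits *)

(** The paths of [phi] are merely measurable, so Riemann sums need not converge to the integral of
    [phi] against a bounded function. Sample points are therefore picked one at a time by averaging:
    for independent uniform points the second moment of the summed errors would grow linearly on
    average, hence deterministic points with linear growth exist, and their sample means converge in
    L^2. Uniform closeness of densities does not bound integrals over the whole line, so laws are
    compared through compactly supported Lipschitz functions. The resulting criterion asks only for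
    convergence of expectations and serves twice: for L^2 limits of Gaussian variables and for the
    almost sure limit of the partial sums. The explicit formula may be infinite on a null set and
    agrees with the mixture only almost everywhere, so comparisons of densities are almost
    everywhere statements. No Gaussian integral beyond the total mass is evaluated: variances are
    known up to one constant, shown to be finite and positive. *)

#[global] Instance ae_filter_lebesgue (R : realType) :
  @Filter R (nbhs (almost_everywhere (@lebesgue_measure R))).
Proof. exact: (@ae_filter_ringOfSetsType _ _ _ (@lebesgue_measure R)). Qed.

Section density.
Context d (Omega : measurableType d) (R : realType) (P : probability Omega R).
Context d' (T : measurableType d') (mu : {sigma_finite_measure set T -> \bar R}).
Local Open Scope ereal_scope.

Lemma density_total (X : Omega -> T) f :
  is_density P mu X f -> \int[mu]_x f x = 1.
Proof. by case=> _ _ _ /(_ setT measurableT) <-; rewrite preimage_setT probability_setT. Qed.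

Lemma density_integrable (X : Omega -> T) f :
  is_density P mu X f -> mu.-integrable setT f.
Proof.
move=> fX; have [_ mf f0 _] := fX; apply/integrableP; split => //.
under eq_integral do rewrite gee0_abs//.
by rewrite (density_total fX) ltry.
Qed.

Lemma density_ae_unique (X : Omega -> T) f g :
  is_density P mu X f -> is_density P mu X g -> ae_eq mu setT f g.
Proof.
move=> fX gX; have [_ mf f0 Ef] := fX; have [_ mg g0 Eg] := gX.
apply: integral_ae_eq => //; first exact: density_integrable fX.
by move=> E _ mE; rewrite -Ef// -Eg.
Qed.

Lemma density_ae_eq (X : Omega -> T) f g :
  measurable_fun setT g -> (forall x, 0 <= g x) -> ae_eq mu setT f g ->
  is_density P mu X f -> is_density P mu X g.
Proof.
move=> mg g0 fg [mX mf f0 Ef]; split => // B mB; rewrite Ef//.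
apply: ge0_ae_eq_integral => //; try exact: measurable_funTS.
by apply: filterS fg => x + _; exact.
Qed.

(** The law of [X] is dominated by [mu]. Its Radon-Nikodym derivative and [f] have the same integral
    over every measurable set, so they agree almost everywhere and the change of variables carries
    over to [f]. *)
Lemma ge0_integral_density (X : Omega -> T) f (h : T -> \bar R) :
    is_density P mu X f -> measurable_fun setT h -> (forall x, 0 <= h x) ->
  \int[P]_w h (X w) = \int[mu]_x (h x * f x).
Proof.
move=> fX mh h0; have [mX mf f0 Ef] := fX.
pose X' : {RV P >-> T} := HB.pack X (isMeasurableFun.Build _ _ _ _ _ mX).
have numu : distribution P X' `<< mu.
  apply/null_content_dominatesP => A mA A0.
  rewrite /distribution /pushforward Ef//.
  by apply: null_set_integral => //; exact: measurable_funTS.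
have -> : \int[P]_w h (X w) = \int[distribution P X']_x h x.
  by rewrite ge0_integral_distribution.
rewrite -(Radon_Nikodym_SigmaFinite.change_of_variables numu)//.
have fi := Radon_Nikodym_SigmaFinite.f_integrable numu.
have mr := measurable_int _ fi.
apply: ge0_ae_eq_integral => //.
- exact: emeasurable_funM.
- exact: emeasurable_funM.
- by move=> x _; rewrite mule_ge0// Radon_Nikodym_SigmaFinite.f_ge0.
- by move=> x _; rewrite mule_ge0.
- apply: ae_eqe_mul2l; apply: integral_ae_eq => // E _ mE.
  by rewrite -Radon_Nikodym_SigmaFinite.f_integral//; exact: Ef.
Qed.

End density.

(** * Affine substitution, and laws determined by half-open intervals *)

Section affine_substitution.
Context (R : realType).
Local Notation mu := (@lebesgue_measure R).
Local Open Scope ereal_scope.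

Let affine (j s : R) (x : R) : R := (j * (x - s))%R.

Let measurable_affine j s : measurable_fun [set: R] (affine j s).
Proof. by apply: measurable_funM => //; exact: measurable_funB. Qed.

Let preimage_affine_ocitv j s a b : j != 0%R ->
  `|j|%:E * mu (affine j s @^-1` `]a, b]) = mu `]a, b].
Proof.
move=> j0; have [jp|jn|j00] := ltrgt0P j; last by rewrite j00 eqxx in j0.
- rewrite (_ : _ @^-1` _ = `]a / j + s, b / j + s]%classic)%R; last first.
    apply/seteqP; split => x; rewrite /affine /= !in_itv/=;
    by rewrite -ltrBrDr -lerBlDr ltr_pdivrMr// ler_pdivlMr// ![(_ * j)%R]mulrC.
  rewrite !lebesgue_measure_itv/= !lte_fin ltrD2r ltr_pM2r ?invr_gt0//.
  case: ifPn => _; last by rewrite mule0.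
  by rewrite -!EFinB -EFinM; congr EFin; field.
- rewrite (_ : _ @^-1` _ = `[b / j + s, a / j + s[%classic)%R; last first.
    apply/seteqP; split => x; rewrite /affine /= !in_itv/=;
    by rewrite -ltrBlDr -lerBrDr ltr_ndivlMr// ler_ndivrMr// ![(_ * j)%R]mulrC andbC.
  rewrite !lebesgue_measure_itv/= !lte_fin ltrD2r ltr_nM2r ?invr_lt0//.
  case: ifPn => _; last by rewrite mule0.
  by rewrite -!EFinB -EFinM; congr EFin; field.
Qed.

(** The image of Lebesgue measure under x |-> j (x - s), scaled by |j|, gives each []a, b]] its
    length, hence is Lebesgue measure. For negative [j] the preimage of []a, b]] is closed on the
    left instead, with the same length. *)
Lemma ge0_integral_affine (f : R -> \bar R) (j s : R) : j != 0%R ->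
  measurable_fun setT f -> (forall x, 0 <= f x) ->
  \int[mu]_x f x = \int[mu]_x (f (j * (x - s))%R * `|j|%:E).
Proof.
move=> j0 mf f0.
pose pf := (pushforward mu (affine j s : measurableTypeR R -> measurableTypeR R) :
  {measure set (measurableTypeR R) -> \bar R}).
pose nu : {measure set (measurableTypeR R) -> \bar R} :=
  mscale (NngNum (normr_ge0 j)) (pf (@measurable_affine j s)).
have muE A : measurable A -> mu A = nu A.
  move=> mA; apply: (@lebesgue_measure_unique _ nu) => // X [[a b] _ <-].
  by rewrite /nu/= /mscale/= /pushforward; apply/esym/preimage_affine_ocitv.
rewrite (eq_measure_integral nu); last by move=> A mA _; exact: muE.
rewrite ge0_integral_mscale//= ge0_integral_pushforward//=; last first.
  exact: measurable_affine.
rewrite preimage_setT -ge0_integralZl//; last first.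
  exact: (measurableT_comp mf (@measurable_affine j s)).
by apply: eq_integral => x _; rewrite muleC.
Qed.

End affine_substitution.

Section law_from_intervals.
Context d (Omega : measurableType d) (R : realType) (P : probability Omega R).
Local Notation mu := (@lebesgue_measure R).
Local Open Scope ereal_scope.

(** Both sides are measures in [B]. They agree on the intervals []a, b]], a generating class stable
    under intersection, and the intervals []-k, k]] exhaust the line with finite mass. *)
Lemma is_density_ocitv (X : Omega -> R) (g : R -> \bar R) :
  measurable_fun setT X -> measurable_fun setT g -> (forall x, 0 <= g x) ->
  (forall a b : R, P (X @^-1` `]a, b]) = \int[mu]_(x in `]a, b]) g x) ->
  is_density P mu X g.
Proof.
move=> mX mg g0 Xg.
have mX' : measurable_fun setT (X : Omega -> measurableTypeR R) by exact: mX.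
pose X' : {RV P >-> measurableTypeR R} :=
  HB.pack X (isMeasurableFun.Build _ _ _ (measurableTypeR R) _ mX').
pose nu0 A : \bar R := \int[mu]_(x in A) g x.
have nu00 : nu0 set0 = 0 by rewrite /nu0 integral_set0.
have nu0_ge0 A : 0 <= nu0 A by exact: integral_ge0.
have nu0_sigma : semi_sigma_additive nu0 by exact: semi_sigma_additive_nng_induced.
pose nu : {measure set (measurableTypeR R) -> \bar R} :=
  HB.pack nu0 (isMeasure.Build _ _ _ nu0 nu00 nu0_ge0 nu0_sigma).
split => // B mB.
rewrite -[LHS]/(distribution P X' B) -[RHS]/(nu B).
apply: (@measure_unique _ R (measurableTypeR R) (@ocitv R)
  (fun k => `](- k%:R)%R, k%:R%R]%classic) _ _ _ _ (distribution P X') nu) => //.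
- by move=> A C mA mC; exact: (@measurableI _ (ocitv_type R)).
- by move=> k; exists (- k%:R, k%:R)%R.
- rewrite -subTset => x _; exists (Num.truncn `|x|%R).+1 => //=.
  have := truncnS_gt `|x|%R; rewrite ltr_norml in_itv/= => /andP[-> xk]/=.
  exact: ltW.
- by move=> _ [[a b] _ <-]; exact: Xg.
- by move=> k; rewrite (le_lt_trans (probability_le1 _ _)) ?ltry//; exact: measurable_itv.
Qed.

End law_from_intervals.

(** * Lipschitz test functions and limits of densities *)

Section trapezoid.
Context (R : realType).
Implicit Types (a b x y : R) (n : nat).

Definition is_lipschitz (h : R -> R) := exists k, forall x y, `|h x - h y| <= k * `|x - y|.

Lemma is_lipschitz_continuous h : is_lipschitz h -> continuous h.
Proof.
move=> [k hk] x; apply/cvgrPdist_le => e e0.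
pose K := `|k| + 1; have K0 : 0 < K by rewrite ltr_pwDr.
near=> y; rewrite (le_trans (hk _ _))//.
rewrite (@le_trans _ _ (K * `|x - y|))//.
  by rewrite ler_wpM2r// (le_trans (ler_norm k))// lerDl.
rewrite -ler_pdivlMl//; near: y.
by apply: cvgr_dist_le; [exact: cvg_id|rewrite mulr_gt0 ?invr_gt0].
Unshelve. all: by end_near. Qed.

(** Two ramps of slope [n], up from [a] and down from [b]. Both lie to the right of their endpoint,
    so that the pointwise limit is exactly the indicator of the half-open []a, b]]. *)
Definition trapezoid a b n x :=
  Num.max 0 (Num.min 1 (Num.min (n%:R * (x - a)) (1 - n%:R * (x - b)))).

Lemma trapezoid_ge0 a b n x : 0 <= trapezoid a b n x.
Proof. by rewrite le_max lexx. Qed.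

Lemma trapezoid_le1 a b n x : trapezoid a b n x <= 1.
Proof. by rewrite ge_max ler01 ge_min lexx. Qed.

Lemma trapezoid_lipschitz a b n : is_lipschitz (trapezoid a b n).
Proof.
have minl (p q r s e : R) : `|p - r| <= e -> `|q - s| <= e ->
    `|Num.min p q - Num.min r s| <= e.
  rewrite /Num.min !ler_norml => /andP[? ?] /andP[? ?].
  by apply/andP; split; case: ltP => ?; case: ltP => ?; lra.
have maxl (p q r s e : R) : `|p - r| <= e -> `|q - s| <= e ->
    `|Num.max p q - Num.max r s| <= e.
  rewrite /Num.max !ler_norml => /andP[? ?] /andP[? ?].
  by apply/andP; split; case: ltP => ?; case: ltP => ?; lra.
exists n%:R => x y; have e0 : 0 <= n%:R * `|x - y| by rewrite mulr_ge0.
apply: maxl; first by rewrite subrr normr0.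
apply: (minl); first by rewrite subrr normr0.
apply: minl.
  rewrite -mulrBr (_ : x - a - (y - a) = x - y); last by ring.
  by rewrite normrM normr_nat.
rewrite (_ : _ - _ = n%:R * (y - x)); last by ring.
by rewrite normrM normr_nat distrC.
Qed.

Lemma trapezoid_support a b n x : (0 < n)%N ->
  trapezoid a b n x <= \1_(`[a, b + 1]) x.
Proof.
move=> n0; have n1 : 1 <= n%:R :> R by rewrite ler1n.
rewrite indicE; case: (boolP (x \in _)) => [_|]; first exact: trapezoid_le1.
move/negP; rewrite inE/= in_itv/= => /negP; rewrite negb_and -!ltNge => /orP h.
rewrite /trapezoid ge_max lexx/= !ge_min; apply/orP; right; apply/orP.
by case: h => ?; [left|right]; nra.
Qed.

Lemma trapezoid_cvg a b x :
  trapezoid a b n x @[n --> \oo] --> (\1_(`]a, b]) x : R).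
Proof.
rewrite indicE; case: (boolP (x \in _)) => [|/negP]; rewrite inE/= in_itv/=.
  move=> /andP[ax xb]; apply/cvgrPdist_le => e e0; near=> n.
  suff -> : trapezoid a b n x = 1 by rewrite subrr normr0 ltW.
  rewrite /trapezoid min_l ?max_r// le_min; apply/andP; split; last first.
    by rewrite lerBrDl gerDr mulr_ge0_le0// subr_le0.
  rewrite -ler_pdivrMr ?subr_gt0//; near: n; exact: nbhs_infty_ger.
move=> /negP; rewrite negb_and -leNgt -ltNge => /orP[xa|bx]; apply/cvgrPdist_le => e e0; near=> n.
  suff -> : trapezoid a b n x = 0 by rewrite subrr normr0 ltW.
  rewrite /trapezoid max_l// !ge_min; apply/orP; right; apply/orP; left.
  by rewrite mulr_ge0_le0// subr_le0.
suff -> : trapezoid a b n x = 0 by rewrite subrr normr0 ltW.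
rewrite /trapezoid max_l// !ge_min; apply/orP; right; apply/orP; right.
rewrite subr_le0 -ler_pdivrMr ?subr_gt0//; near: n; exact: nbhs_infty_ger.
Unshelve. all: by end_near. Qed.

End trapezoid.

Lemma cvge_le_errors (R : realType) (u : nat -> \bar R) (l : \bar R) (e : nat -> R) :
  l \is a fin_num -> e @ \oo --> (0 : R) ->
  (forall k, u k <= l + (e k)%:E)%E -> (forall k, l <= u k + (e k)%:E)%E ->
  u @ \oo --> l.
Proof.
move=> lfin e0 ul lu.
have ee : ((e k)%:E @[k --> \oo] --> (0 : \bar R))%E.
  by apply: cvg_EFin => //; exact: nearW.
apply: (@squeeze_cvge _ _ _ _ (fun k => l - (e k)%:E)%E _ (fun k => l + (e k)%:E)%E).
- by near=> k; rewrite leeBlDr// lu ul.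
- have := @cvgeB _ _ _ _ (cst l) _ l _ _ (cvg_cst l) ee; rewrite sube0; apply.
  by rewrite oppe0 fin_num_adde_defl.
- have := @cvgeD _ _ _ _ (cst l) _ l _ _ (cvg_cst l) ee; rewrite adde0; apply.
  by rewrite fin_num_adde_defl.
Unshelve. all: by end_near. Qed.

Section density_limit.
Context d (Omega : measurableType d) (R : realType) (P : probability Omega R).
Local Notation mu := (@lebesgue_measure R).
Local Open Scope ereal_scope.

(** Against a trapezoid [h], a gap [e_ k] between densities costs at most [e_ k] times the length of
    a fixed interval, so the integrals of [h] times [p_ k] tend to that of [h] times [g]. They also
    tend to the expectation of [h (X w)], and the trapezoids approximate the indicator of []a,
    b]]. *)
Lemma density_limit (X_ : nat -> Omega -> R) (X : Omega -> R)
    (p_ : nat -> R -> \bar R) (g : R -> \bar R) (e_ : nat -> R) :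
  (forall k, is_density P mu (X_ k) (p_ k)) ->
  measurable_fun setT X -> measurable_fun setT g -> (forall u, 0 <= g u) ->
  \int[mu]_u g u < +oo ->
  (forall k, {ae mu, forall u, p_ k u <= g u + (e_ k)%:E}) ->
  (forall k, {ae mu, forall u, g u <= p_ k u + (e_ k)%:E}) ->
  (forall k, 0 <= e_ k)%R -> e_ @ \oo --> (0 : R)%R ->
  (forall h : R -> R, is_lipschitz h -> (forall x, 0 <= h x <= 1)%R ->
    \int[P]_w (h (X_ k w))%:E @[k --> \oo] --> \int[P]_w (h (X w))%:E) ->
  is_density P mu X g.
Proof.
move=> Xp mX mg g0 goo pg gp e_ge0 e0 Xh; apply: is_density_ocitv => // a b.
have gi : mu.-integrable setT g.
  by apply/integrableP; split => //; under eq_integral do rewrite gee0_abs//.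
have mtr n : measurable_fun setT (trapezoid a b n).
  apply: continuous_measurable_fun; apply: is_lipschitz_continuous.
  exact: trapezoid_lipschitz.
have mtrE n : measurable_fun setT (EFin \o trapezoid a b n) by exact/measurable_EFinP.
have trE n : \int[P]_w (trapezoid a b n.+1 (X w))%:E =
    \int[mu]_u ((trapezoid a b n.+1 u)%:E * g u).
  set h := trapezoid a b n.+1.
  have h0 u : 0 <= (h u)%:E by rewrite lee_fin trapezoid_ge0.
  have [l lE] : exists l : R, mu `[a, (b + 1)%R] = l%:E.
    rewrite lebesgue_measure_itv/=; case: ifPn => _; last by exists 0%R.
    by exists (b + 1 - a)%R.
  pose J := \int[mu]_u ((h u)%:E * g u).
  have mh : measurable_fun setT (fun u => (h u)%:E) by exact: (mtrE n.+1).
  have mhg : measurable_fun setT (fun u => (h u)%:E * g u) by exact: emeasurable_funM.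
  have Jfin : J \is a fin_num.
    rewrite ge0_fin_numE; last by apply: integral_ge0 => u _; exact: mule_ge0.
    apply: le_lt_trans goo; apply: ge0_le_integral => //.
    - by move=> u _; exact: mule_ge0.
    - by move=> u _; rewrite gee_pMl// ?lee_fin ?trapezoid_ge0 ?trapezoid_le1.
  have m1 : measurable_fun setT (fun u => (\1_(`[a, (b + 1)%R]) u)%:E : \bar R).
    by apply/measurable_EFinP; exact: measurable_indic.
  (* Stated for two arbitrary functions because it is applied in both directions between [p_ k] and
     [g]. *)
  have step (p q : R -> \bar R) (e : R) : (0 <= e)%R -> measurable_fun setT p ->
      measurable_fun setT q -> (forall u, 0 <= p u) -> (forall u, 0 <= q u) ->
      {ae mu, forall u, p u <= q u + e%:E} ->
    \int[mu]_u ((h u)%:E * p u) <= \int[mu]_u ((h u)%:E * q u) + (e * l)%:E.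
    move=> e0' mp mq p0 q0 pq.
    have -> : (e * l)%:E = \int[mu]_u (e%:E * (\1_(`[a, (b + 1)%R]) u)%:E).
      rewrite ge0_integralZl//.
      by rewrite integral_indic// setIT EFinM -lE.
    rewrite -ge0_integralD//; last 4 first.
    - by move=> u _; exact: mule_ge0.
    - exact: emeasurable_funM.
    - by move=> u _; apply: mule_ge0; rewrite ?lee_fin.
    - exact: emeasurable_funM.
    apply: ae_ge0_le_integral => //.
    - by move=> u _; exact: mule_ge0.
    - exact: emeasurable_funM.
    - by move=> u _; apply: adde_ge0; [exact: mule_ge0|rewrite mule_ge0 ?lee_fin].
    - apply: emeasurable_funD; exact: emeasurable_funM.
    - apply: filterS pq => u pqu _.
      rewrite (le_trans (lee_wpmul2l (h0 u) pqu))// ge0_muleDr ?lee_fin//.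
      by rewrite leeD2l// muleC -!EFinM lee_fin ler_wpM2l// trapezoid_support.
  pose L k := \int[P]_w (h (X_ k w))%:E.
  have LE k : L k = \int[mu]_u ((h u)%:E * p_ k u).
    by rewrite /L (ge0_integral_density (Xp k) (mtrE n.+1)).
  have LJ k : L k <= J + (e_ k * l)%:E.
    by rewrite LE; have [_ mp p0 _] := Xp k; exact: step.
  have JL k : J <= L k + (e_ k * l)%:E.
    by rewrite LE; have [_ mp p0 _] := Xp k; exact: step.
  suff : L k @[k --> \oo] --> J.
    have h01 x : (0 <= h x <= 1)%R by rewrite trapezoid_ge0 trapezoid_le1.
    have XL := Xh h (trapezoid_lipschitz a b n.+1) h01.
    by move=> LJc; apply: cvg_unique XL LJc.
  apply: (@cvge_le_errors _ _ _ (fun k => e_ k * l)%R Jfin) => //.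
  by have := @cvgMr_tmp _ _ _ _ e_ 0%R l e0; rewrite mul0r; exact.
have mocitv : measurable `]a, b]%classic by exact: measurable_itv.
have cvgt u : (trapezoid a b n.+1 u)%:E @[n --> \oo] --> ((\1_(`]a, b]) u)%:E : \bar R).
  apply: cvg_EFin; first exact: nearW.
  by rewrite (cvg_shiftS (trapezoid a b ^~ u)); exact: trapezoid_cvg.
have mi : measurable_fun setT (fun u => (\1_(`]a, b]) u)%:E : \bar R).
  by apply/measurable_EFinP; exact: measurable_indic.
(* Only now does [n] grow, [k] having been eliminated: the dominating function is 1 under [P] and
   [g] under Lebesgue measure. *)
have lhs : \int[P]_w (trapezoid a b n.+1 (X w))%:E @[n --> \oo] -->
    P (X @^-1` `]a, b]).
  have -> : P (X @^-1` `]a, b]) = \int[P]_w (\1_(`]a, b]) (X w))%:E.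
    by rewrite -(setIT (X @^-1` _)) -integral_indic// -[X in measurable X]setTI; exact: mX.
  apply: (@dominated_cvg _ _ _ P setT measurableT _ _ (cst 1)) => //.
  - move=> n; exact: (measurableT_comp (mtrE _)).
  - exact: finite_measure_integrable_cst.
  - move=> n w _.
    by rewrite gee0_abs lee_fin ?trapezoid_ge0// trapezoid_le1.
have rhs : \int[mu]_u ((trapezoid a b n.+1 u)%:E * g u) @[n --> \oo] -->
    \int[mu]_(u in `]a, b]) g u.
  rewrite [X in _ --> X](_ : _ = \int[mu]_u ((\1_(`]a, b]) u)%:E * g u)); last first.
    by rewrite integral_mkcond epatch_indic; apply: eq_integral => u _; rewrite muleC.
  have [] := @dominated_convergence _ _ _ mu setT measurableT
    (fun n u => (trapezoid a b n.+1 u)%:E * g u)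
    (fun u => (\1_(`]a, b]) u)%:E * g u) g _ _ _ gi _ => //.
  - by move=> n; apply: emeasurable_funM => //; exact: mtrE.
  - exact: emeasurable_funM.
  - apply: filterS (integrable_ae measurableT gi) => u /(_ I) gu _.
    exact: cvgeZr.
  - apply: aeW => u n _; rewrite gee0_abs ?mule_ge0 ?lee_fin ?trapezoid_ge0//.
    by rewrite gee_pMl// ?lee_fin ?trapezoid_ge0 ?trapezoid_le1.
have {}lhs : \int[mu]_u ((trapezoid a b n.+1 u)%:E * g u) @[n --> \oo] -->
    P (X @^-1` `]a, b]).
  by rewrite -(funext trE).
exact: cvg_unique lhs rhs.
Qed.

End density_limit.

Section limn_einf_bounds.
Context (R : realType).
Implicit Types (u : nat -> \bar R) (c : \bar R).
Local Open Scope ereal_scope.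

Lemma limn_einf_ge u c k : (forall n, (k <= n)%N -> c <= u n) -> c <= limn_einf u.
Proof.
move=> cu; rewrite limn_einf_lim; apply: lime_ge; first exact: is_cvg_einfs.
near=> n; apply: le_ereal_inf_tmp => _ [m /= nm <-]; apply: cu.
by apply: leq_trans nm; near: n; exists k.
Unshelve. all: by end_near. Qed.

Lemma limn_einf_le u c k : (forall n, (k <= n)%N -> u n <= c) -> limn_einf u <= c.
Proof.
move=> uc; rewrite limn_einf_lim; apply: lime_le; first exact: is_cvg_einfs.
near=> n; apply: (@le_trans _ _ (u n)); first by apply: ereal_inf_lbound; exists n => /=.
by apply: uc; near: n; exists k.
Unshelve. all: by end_near. Qed.

End limn_einf_bounds.

Section uniform_limit_of_densities.
Context d (Omega : measurableType d) (R : realType) (P : probability Omega R).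
Local Notation mu := (@lebesgue_measure R).
Local Open Scope ereal_scope.

Lemma density_uniform_limit (X_ : nat -> Omega -> R) (X : Omega -> R)
    (p_ : nat -> R -> \bar R) (e_ : nat -> R) :
  (forall k, is_density P mu (X_ k) (p_ k)) -> measurable_fun setT X ->
  {ae P, forall w, X_ k w @[k --> \oo] --> X w} ->
  (forall k, {ae mu, forall u, p_ k u <= p_ k.+1 u + (e_ k)%:E}) ->
  (forall k, {ae mu, forall u, p_ k.+1 u <= p_ k u + (e_ k)%:E}) ->
  (forall k, 0 <= e_ k)%R -> cvgn (series e_) ->
  exists g : R -> R, is_density P mu X (EFin \o g) /\
    'N[mu]_+oo[(fun u => p_ k u - (g u)%:E)] @[k --> \oo] --> 0.
Proof.
move=> Xp mX XX pS Sp e0 ecvg.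
have mp k : measurable_fun setT (p_ k) by have [] := Xp k.
have p0 k u : 0 <= p_ k u by have [_ _ + _] := Xp k; exact.
(* The tail of the series bounds the gap between [p_ k] and every later [p_ n], hence the gap to the
   limit. *)
pose E k : R := (limn (series e_) - series e_ k)%R.
have seriesE (k q : nat) : series e_ (k + q)%N = (series e_ k + \sum_(k <= j < k + q) e_ j)%R.
  by rewrite /series/= (big_cat_nat _ (leq_addr q k)).
have nds : {homo series e_ : n m / (n <= m)%N >-> (n <= m)%R}.
  move=> n m nm; rewrite -(subnKC nm) seriesE lerDl.
  by apply: sumr_ge0 => i _.
have tail (k q : nat) : (\sum_(k <= j < k + q) e_ j <= E k)%R.
  by rewrite lerBrDl -seriesE; exact: nondecreasing_cvgn_le.
have E0 k : (0 <= E k)%R by rewrite subr_ge0; exact: nondecreasing_cvgn_le.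
have Ecvg : E @ \oo --> (0 : R)%R.
  by rewrite -(subrr (limn (series e_))); apply: cvgB => //; exact: cvg_cst.
(* The lower limit is measurable and defined at every point, whereas convergence is known only
   almost everywhere. Fatou's lemma bounds its integral by 1. *)
pose g u := limn_einf (p_ ^~ u).
have g0 u : 0 <= g u by apply: (@limn_einf_ge _ _ _ 0%N) => n _.
have mg : measurable_fun setT g.
  rewrite /g /limn_einf; apply: (measurableT_comp (@oppe_measurable _ _)).
  by apply: measurable_fun_limn_esup => n; exact: measurableT_comp.
have goo : \int[mu]_u g u < +oo.
  apply: (@le_lt_trans _ _ 1); last exact: ltry.
  apply: (le_trans (fatou mu measurableT mp _)) => //.
  by apply: (@limn_einf_le _ _ _ 0%N) => n _; rewrite (density_total (Xp n)).
have [pg gp] : (forall k, {ae mu, forall u, p_ k u <= g u + (E k)%:E}) /\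
    (forall k, {ae mu, forall u, g u <= p_ k u + (E k)%:E}).
  have /ae_foralln pS' := pS; have /ae_foralln Sp' := Sp.
  have step1 u : (forall k, p_ k u <= p_ k.+1 u + (e_ k)%:E) -> forall k q,
      p_ k u <= p_ (k + q)%N u + (\sum_(k <= j < k + q) e_ j)%:E.
    move=> h k; elim=> [|q ih]; first by rewrite addn0 big_geq// adde0.
    rewrite (le_trans ih)// addnS big_nat_recr ?leq_addr//=.
    by rewrite EFinD addeA addeAC leeD2r.
  have step2 u : (forall k, p_ k.+1 u <= p_ k u + (e_ k)%:E) -> forall k q,
      p_ (k + q)%N u <= p_ k u + (\sum_(k <= j < k + q) e_ j)%:E.
    move=> h k; elim=> [|q ih]; first by rewrite addn0 big_geq// adde0.
    rewrite addnS (le_trans (h _))// big_nat_recr ?leq_addr//=.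
    by rewrite EFinD addeA leeD2r.
  split => k.
    apply: filterS pS' => u /step1 h; rewrite -leeBlDr//.
    apply: (@limn_einf_ge _ _ _ k) => n kn; rewrite leeBlDr// -(subnKC kn).
    by rewrite (le_trans (h k (n - k)%N))// leeD2l// lee_fin.
  apply: filterS Sp' => u /step2 h.
  apply: (@limn_einf_le _ _ _ k) => n kn; rewrite -(subnKC kn).
  by rewrite (le_trans (h k (n - k)%N))// leeD2l// lee_fin.
have Xg : is_density P mu X g.
  apply: (@density_limit _ _ _ P X_ X p_ g E) => // h hl h01.
  have ch := is_lipschitz_continuous hl.
  have mh : measurable_fun setT (EFin \o h).
    by apply/measurable_EFinP; exact: continuous_measurable_fun.
  have [] := @dominated_convergence _ _ _ P setT measurableT
    (fun k w => (h (X_ k w))%:E) (fun w => (h (X w))%:E) (cst 1) => //.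
  - by move=> k; apply: (measurableT_comp mh); have [] := Xp k.
  - exact: (measurableT_comp mh).
  - apply: filterS XX => w Xw _; apply: cvg_EFin; first exact: nearW.
    exact: (cvg_comp _ _ Xw (ch _)).
  - exact: finite_measure_integrable_cst.
  - apply: aeW => w n _; have /andP[h0 h1] := h01 (X_ n w).
    by rewrite /= ger0_norm// lee_fin.
have gi : mu.-integrable setT g by exact: density_integrable Xg.
have gfin : {ae mu, forall u, g u \is a fin_num}.
  by apply: filterS (integrable_ae measurableT gi) => u /(_ I).
(* Integrability makes [g] finite almost everywhere; [fine] puts 0 on the remaining null set. *)
exists (fine \o g); split.
  apply: density_ae_eq Xg => //.
  - by apply/measurable_EFinP; exact: measurableT_comp.
  - by move=> u; rewrite lee_fin fine_ge0.
  - by apply: filterS gfin => u gu _; rewrite /= fineK.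
have Nle k : 'N[mu]_+oo[(fun u => p_ k u - (fine (g u))%:E)] <= (E k)%:E.
  rewrite unlock; case: ifPn => [_|_]; last by rewrite lee_fin.
  apply: ereal_inf_lbound => /=.
  near=> u; have gu : g u \is a fin_num by near: u.
  have pu : p_ k u <= g u + (E k)%:E by near: u.
  have up : g u <= p_ k u + (E k)%:E by near: u.
  have pfin : p_ k u \is a fin_num.
    by rewrite ge0_fin_numE// (le_lt_trans pu)// -(fineK gu) -EFinD ltry.
  move: pu up; rewrite /= -(fineK pfin) -(fineK gu) /= -!EFinD !lee_fin.
  by move=> pu up; rewrite ler_norml; lra.
apply: (@squeeze_cvge _ _ _ _ (fun=> 0) _ (fun k => (E k)%:E)).
- by near=> k; rewrite Lnorm_ge0 Nle.
- exact: cvg_cst.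
- by apply: cvg_EFin => //; exact: nearW.
Unshelve. all: by end_near. Qed.

End uniform_limit_of_densities.

(** * Lipschitz dependence of the normal density on its parameters *)

Section normal_pdf_lipschitz.
Context (R : realType).
Implicit Types m s u x y z t : R.

Let bell (z : R) : R := expR (- z ^+ 2 / 2).

(** This is [1 + y <= expR y] at y = z^2 / 4, squared. Bounds on a polynomial times [bell] thereby
    become polynomial inequalities. *)
Let bell_bound (b z : R) : b <= (1 + z ^+ 2 / 4) ^+ 2 -> b * bell z <= 1.
Proof.
move=> h; rewrite /bell mulNr expRN ler_pdivrMr ?expR_gt0// mul1r.
rewrite (le_trans h)// (_ : z ^+ 2 / 2 = 2%:R * (z ^+ 2 / 4)); last by field.
rewrite expRM_natl ler_sqr ?nnegrE ?expR_ge0 ?addr_ge0 ?divr_ge0 ?sqr_ge0//.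
exact: expR_ge1Dx.
Qed.

Let is_derive_bell (x : R) : is_derive x 1 bell (- x * bell x).
Proof.
have h : is_derive x 1 ((- 2^-1) \*: (@id R ^+ 2)) (- x).
  apply: is_derive_eq; rewrite /= expr1 /GRing.scale/= mulr1; by field.
have -> : bell = expR \o ((- 2^-1) \*: (@id R ^+ 2)).
  by apply/funext => z; rewrite /bell /= !fctE /GRing.scale/=; congr expR; field.
by rewrite mulrC; apply: is_derive1_comp.
Qed.

Let is_derive_Mbell (x : R) :
  is_derive x 1 (fun x => x * bell x) ((1 - x ^+ 2) * bell x).
Proof.
have := is_derive_bell x => h.
apply: (@is_derive_eq _ _ _ (id * bell)); rewrite /GRing.scale/=; ring.
Qed.

Let MVT_lipschitz (f df : R -> R) (k : R) : (forall x, is_derive x 1 f (df x)) ->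
  (forall x, `|df x| <= k) -> forall x y, `|f x - f y| <= k * `|x - y|.
Proof.
move=> fdf dfk x y.
wlog yx : x y / y <= x.
  by move=> wl; have [/wl//|/ltW/wl] := leP y x; rewrite distrC (distrC x).
have [c _ ->] := MVT_segment yx (fun z _ => fdf z)
  (derivable_within_continuous (fun z _ => @ex_derive _ _ _ _ _ _ _ (fdf z))).
by rewrite normrM ler_wpM2r.
Qed.

Let bell_lipschitz x y : `|bell x - bell y| <= `|x - y|.
Proof.
rewrite -[leRHS]mul1r; apply: (MVT_lipschitz is_derive_bell) => {}x.
rewrite mulNr normrN ler_norml lerNl -mulNr !bell_bound//; nra.
Qed.

(** After multiplication by |y| the left side compares x |-> x bell x at t y and t' y, and the
    derivative (1 - x^2) bell x is at most 1 in absolute value. The factor |y| cancels, so the bound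
    is uniform in [y]. The variable [t] stands for an inverse standard deviation. *)
Let Mbell_lipschitz (t t' y : R) :
  `|t * bell (t * y) - t' * bell (t' * y)| <= `|t - t'|.
Proof.
have [->|y0] := eqVneq y 0.
  by rewrite !mulr0 /bell expr0n/= oppr0 mul0r expR0 !mulr1.
have yp : 0 < `|y| by rewrite normr_gt0.
rewrite -(ler_pM2r yp).
rewrite -!normrM !mulrBl -[leRHS]mul1r mulrAC [X in _ - X]mulrAC.
apply: (MVT_lipschitz is_derive_Mbell) => x.
rewrite ler_norml lerNl -mulNr !bell_bound//; nra.
Qed.

Lemma normal_pdf_lipschitz (c m m' s s' u : R) : 0 < c -> c <= s -> c <= s' ->
  `|normal_pdf m s u - normal_pdf m' s' u| <=
    (`|m - m'| + `|s - s'|) / c ^+ 2.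
Proof.
move=> c0 cs cs'; have s0 : 0 < s by exact: lt_le_trans cs.
have s'0 : 0 < s' by exact: lt_le_trans cs'.
pose K : R := (Num.sqrt (pi *+ 2))^-1.
have pdfE a b : 0 < b -> normal_pdf a b u = K * (b^-1 * bell (b^-1 * (u - a))).
  move=> b0; rewrite normal_pdfE ?gt_eqF// /normal_peak /normal_fun.
  rewrite -mulrnAr sqrtrM ?sqr_ge0// sqrtr_sqr gtr0_norm// invfM mulrCA -mulrA.
  congr (_ * (_ * _)); rewrite /bell; congr expR; field.
  by rewrite gt_eqF.
rewrite !pdfE// -mulrBr normrM.
have K1 : `|K| <= 1.
  have pi1 : 1 <= pi *+ 2 :> R by have := pi_ge2 R; lra.
  rewrite ger0_norm ?invr_ge0 ?sqrtr_ge0// invf_le1 ?sqrtr_gt0 ?(lt_le_trans _ pi1)//.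
  by rewrite -[leLHS]sqrtr1 ler_sqrt// (le_trans _ pi1).
rewrite (le_trans (ler_wpM2r (normr_ge0 _) K1))// mul1r.
(* The intermediate density has parameters [m] and [s']: the deviation moves at fixed mean, then the
   mean at fixed deviation. *)
rewrite (le_trans (ler_distD (s'^-1 * bell (s'^-1 * (u - m))) _ _))// addrC mulrDl.
apply: lerD.
  rewrite -mulrBr normrM gtr0_norm ?invr_gt0//.
  rewrite (le_trans (ler_wpM2l _ (bell_lipschitz _ _))) ?invr_ge0 ?(ltW s'0)//.
  rewrite -mulrBr normrM gtr0_norm ?invr_gt0// mulrA [leRHS]mulrC.
  rewrite (_ : u - m - (u - m') = m' - m); last by ring.
  rewrite distrC; apply: ler_wpM2r => //.
  rewrite -expr2 exprVn lef_pV2 ?posrE ?exprn_gt0//.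
  by rewrite ler_sqr ?nnegrE// ltW.
rewrite (le_trans (Mbell_lipschitz _ _ _))//.
rewrite (_ : s^-1 - s'^-1 = (s' - s) / (s * s')); last by field; rewrite !gt_eqF.
rewrite normrM distrC; apply: ler_wpM2l => //; rewrite gtr0_norm ?invr_gt0 ?mulr_gt0//.
by rewrite lef_pV2 ?posrE ?exprn_gt0 ?mulr_gt0// expr2 ler_pM// ltW.
Qed.

End normal_pdf_lipschitz.

(** * Second moments and Gaussian variables *)

Section second_moments.
Context d (Omega : measurableType d) (R : realType) (P : probability Omega R).
Implicit Types (X Y Z : Omega -> R) (a b c : R).

Definition mean X : R := fine 'E_P[X]%E.
Definition cov X Y : R := fine (covariance P X Y).
Definition sd X : R := Num.sqrt (cov X X).

Lemma Lfun2P X : X \in Lfun P 2%:E <->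
  measurable_fun setT X /\ (\int[P]_w ((X w) ^+ 2)%:E < +oo)%E.
Proof.
split=> [X2|[mX X2]].
  split; first by move: X2; rewrite inE => /andP[/[!inE]].
  have /integrableP[_] := Lfun2_integrable_sqr X2.
  by under eq_integral do rewrite gee0_abs ?lee_fin ?sqr_ge0//.
rewrite inE; apply/andP; split; rewrite inE//=.
rewrite /finite_norm unlock poweR_lty//.
by under eq_integral do rewrite /= powR_mulrn// real_normK ?num_real//.
Qed.

Lemma Lfun2_measurable X : X \in Lfun P 2%:E -> measurable_fun setT X.
Proof. by move=> /Lfun2P[]. Qed.

Lemma Lfun2_Lfun1 X : X \in Lfun P 2%:E -> X \in Lfun P 1.
Proof. by apply: Lfun_subset12; exact: fin_num_measure. Qed.

Lemma Lfun2D X Y : X \in Lfun P 2%:E -> Y \in Lfun P 2%:E -> X \+ Y \in Lfun P 2%:E.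
Proof. by move=> X2 Y2; rewrite rpredD//= lee1n. Qed.

Lemma Lfun2B X Y : X \in Lfun P 2%:E -> Y \in Lfun P 2%:E -> X \- Y \in Lfun P 2%:E.
Proof. by move=> X2 Y2; rewrite rpredB//= lee1n. Qed.

Lemma Lfun2Z a X : X \in Lfun P 2%:E -> (fun w => a * X w) \in Lfun P 2%:E.
Proof.
move=> X2; have -> : (fun w => a * X w) = a \o* X by apply/funext => w /=; rewrite mulrC.
by rewrite Lfun_scale// ler1n.
Qed.

Lemma Lfun2_sum n (b : 'I_n -> R) (X : 'I_n -> Omega -> R) :
  (forall i, X i \in Lfun P 2%:E) ->
  (fun w => \sum_(i < n) b i * X i w) \in Lfun P 2%:E.
Proof.
elim: n b X => [|n ih] b X X2.
  by under eq_fun do rewrite big_ord0; exact: Lfun_cst.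
under eq_fun do rewrite big_ord_recr/=.
by apply: Lfun2D; [exact: ih|exact: Lfun2Z].
Qed.

Lemma meanD X Y : X \in Lfun P 2%:E -> Y \in Lfun P 2%:E ->
  mean (X \+ Y) = mean X + mean Y.
Proof.
move=> /Lfun2_Lfun1 X1 /Lfun2_Lfun1 Y1.
by rewrite /mean expectationD// fineD// expectation_fin_num.
Qed.

Lemma meanZ a X : X \in Lfun P 2%:E -> mean (fun w => a * X w) = a * mean X.
Proof.
move=> /Lfun2_Lfun1 X1.
have -> : (fun w => a * X w) = a \o* X by apply/funext => w /=; rewrite mulrC.
by rewrite /mean expectationZl// fineM// expectation_fin_num.
Qed.

Lemma mean_sum n (b : 'I_n -> R) (X : 'I_n -> Omega -> R) :
  (forall i, X i \in Lfun P 2%:E) ->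
  mean (fun w => \sum_(i < n) b i * X i w) = \sum_(i < n) b i * mean (X i).
Proof.
elim: n b X => [|n ih] b X X2.
  under eq_fun do rewrite big_ord0.
  by rewrite big_ord0 /mean -[X in 'E_P[X]%E]/(cst 0) expectation_cst.
under eq_fun do rewrite big_ord_recr/=.
by rewrite meanD ?meanZ ?ih ?big_ord_recr//; [exact: Lfun2_sum|exact: Lfun2Z].
Qed.

Lemma covC X Y : cov X Y = cov Y X.
Proof. by rewrite /cov covarianceC. Qed.

Let cov_fin X Y : X \in Lfun P 2%:E -> Y \in Lfun P 2%:E ->
  covariance P X Y \is a fin_num.
Proof.
move=> X2 Y2; apply: covariance_fin_num; try exact: Lfun2_Lfun1.
exact: Lfun2_mul_Lfun1.
Qed.

Lemma mean_cst c : mean (cst c) = c.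
Proof. by rewrite /mean expectation_cst. Qed.

Lemma covE X : X \in Lfun P 2%:E ->
  (cov X X)%:E = (\int[P]_w ((X w - mean X) ^+ 2)%:E)%E.
Proof.
move=> X2; rewrite /cov fineK ?cov_fin// covariance.unlock {1}expectation.unlock.
by apply: eq_integral => w _ /=; rewrite -expr2.
Qed.

Lemma covDl X Y Z : X \in Lfun P 2%:E -> Y \in Lfun P 2%:E -> Z \in Lfun P 2%:E ->
  cov (X \+ Y) Z = cov X Z + cov Y Z.
Proof. by move=> X2 Y2 Z2; rewrite /cov covarianceDl// fineD// cov_fin. Qed.

Lemma covZl a X Y : X \in Lfun P 2%:E -> Y \in Lfun P 2%:E ->
  cov (fun w => a * X w) Y = a * cov X Y.
Proof.
move=> X2 Y2.
have -> : (fun w => a * X w) = a \o* X by apply/funext => w /=; rewrite mulrC.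
rewrite /cov covarianceZl; try exact: Lfun2_Lfun1; last exact: Lfun2_mul_Lfun1.
by rewrite fineM// cov_fin.
Qed.

Lemma cov_suml n (b : 'I_n -> R) (X : 'I_n -> Omega -> R) Y :
  (forall i, X i \in Lfun P 2%:E) -> Y \in Lfun P 2%:E ->
  cov (fun w => \sum_(i < n) b i * X i w) Y = \sum_(i < n) b i * cov (X i) Y.
Proof.
move=> + Y2; elim: n b X => [|n ih] b X X2.
  under eq_fun do rewrite big_ord0.
  by rewrite big_ord0 /cov -[X in covariance P X _]/(cst 0) covariance_cst_l.
under eq_fun do rewrite big_ord_recr/=.
rewrite covDl ?covZl ?ih ?big_ord_recr//; [exact: Lfun2_sum|exact: Lfun2Z].
Qed.

Lemma cov_ge0 X : 0 <= cov X X.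
Proof. by rewrite fine_ge0// variance_ge0. Qed.

Lemma sqr_sd X : sd X ^+ 2 = cov X X.
Proof. by rewrite sqr_sqrtr// cov_ge0. Qed.

Lemma sd_ge0 X : 0 <= sd X. Proof. exact: sqrtr_ge0. Qed.

Lemma cov_le_sd X Y : X \in Lfun P 2%:E -> Y \in Lfun P 2%:E ->
  `|cov X Y| <= sd X * sd Y.
Proof.
have le Z : Z \in Lfun P 2%:E -> Y \in Lfun P 2%:E -> cov Z Y <= sd Z * sd Y.
  move=> Z2 Y2; rewrite -lee_fin /cov fineK ?cov_fin// EFinM.
  rewrite (le_trans (covariance_le Z2 Y2))//.
  by rewrite /variance -(fineK (cov_fin Z2 Z2)) -(fineK (cov_fin Y2 Y2)).
move=> X2 Y2; rewrite ler_norml le// andbT lerNl.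
have N2 : (fun w => -1 * X w) \in Lfun P 2%:E by exact: Lfun2Z.
have := le _ N2 Y2; rewrite covZl// mulN1r => /le_trans; apply.
by rewrite /sd covZl// (covC X) covZl// !mulN1r opprK.
Qed.

(** The triangle inequality for [sd] follows from Cauchy-Schwarz; it is applied to X = (X - Y) + Y
    and to Y = (Y - X) + X. *)
Lemma sd_lipschitz X Y : X \in Lfun P 2%:E -> Y \in Lfun P 2%:E ->
  `|sd X - sd Y| <= sd (X \- Y).
Proof.
have tri Z U : Z \in Lfun P 2%:E -> U \in Lfun P 2%:E -> sd (Z \+ U) <= sd Z + sd U.
  move=> Z2 U2; have ZU2 := Lfun2D Z2 U2.
  rewrite -ler_sqr ?nnegrE ?sd_ge0 ?addr_ge0 ?sd_ge0// sqr_sd.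
  rewrite covDl// ![cov _ (Z \+ U)]covC !covDl// sqrrD !sqr_sd (covC U Z).
  have := le_trans (ler_norm _) (cov_le_sd Z2 U2); lra.
have sdN Z U : Z \in Lfun P 2%:E -> U \in Lfun P 2%:E -> sd (Z \- U) = sd (U \- Z).
  move=> Z2 U2.
  have -> : Z \- U = (fun w => -1 * (U \- Z) w).
    by apply/funext => w /=; rewrite mulN1r opprB.
  have UZ2 := Lfun2B U2 Z2.
  by rewrite /sd covZl ?Lfun2Z// (covC (U \- Z)) covZl// !mulN1r opprK.
move=> X2 Y2; rewrite ler_norml; apply/andP; split.
  rewrite lerNl opprB lerBlDr sdN//.
  have := tri _ _ (Lfun2B Y2 X2) X2.
  by rewrite (_ : (Y \- X) \+ X = Y)//; apply/funext => w /=; rewrite subrK.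
rewrite lerBlDr; have := tri _ _ (Lfun2B X2 Y2) Y2.
by rewrite (_ : (X \- Y) \+ Y = X)//; apply/funext => w /=; rewrite subrK.
Qed.

(** Integrate 2 b |X| <= b^2 + X^2 and divide by 2 b. *)
Lemma integral_norm_le X b : measurable_fun setT X -> 0 < b ->
  (\int[P]_w ((X w) ^+ 2)%:E <= (b ^+ 2)%:E)%E ->
  (\int[P]_w `|X w|%:E <= b%:E)%E.
Proof.
move=> mX b0 Xb.
have mX2 : measurable_fun setT (fun w => ((X w) ^+ 2)%:E).
  by apply/measurable_EFinP; exact: measurable_funX.
have mXn : measurable_fun setT (fun w => `|X w|%:E).
  by apply/measurable_EFinP; exact: measurableT_comp.
rewrite -(@lee_pmul2l _ (2 * b)%:E) ?lte_fin ?mulr_gt0//.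
rewrite -ge0_integralZl//; last by rewrite lee_fin mulr_ge0 ?ltW.
apply: (@le_trans _ _ (\int[P]_w ((b ^+ 2)%:E + ((X w) ^+ 2)%:E))%E).
  apply: ge0_le_integral => //.
  - by move=> w _; rewrite mule_ge0 ?lee_fin// mulr_ge0 ?ltW.
  - by apply: measurable_funeM.
  - exact: emeasurable_funD.
  - move=> w _; rewrite -EFinD -EFinM lee_fin -(real_normK (num_real (X w))).
    by have := sqr_ge0 (b - `|X w|); nra.
rewrite ge0_integralD//; last 2 first.
- by move=> w _; rewrite lee_fin sqr_ge0.
- by move=> w _; rewrite lee_fin sqr_ge0.
rewrite integral_cst//= (probability_setT P) mule1 (le_trans (leeD2l _ Xb))//.
by rewrite -EFinD -EFinM lee_fin; nra.
Qed.

Lemma mean_norm_le X b : X \in Lfun P 2%:E -> 0 < b ->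
  (\int[P]_w ((X w) ^+ 2)%:E <= (b ^+ 2)%:E)%E -> `|mean X| <= b.
Proof.
move=> X2 b0 Xb; rewrite -lee_fin; apply: le_trans (integral_norm_le _ b0 Xb); last first.
  exact: Lfun2_measurable.
have fX := expectation_fin_num (Lfun2_Lfun1 X2).
rewrite -abse_EFin /mean fineK// unlock.
by rewrite (le_trans (le_abse_integral P measurableT _))//; apply/measurable_EFinP/Lfun2_measurable.
Qed.

Lemma sd_le X b : X \in Lfun P 2%:E -> 0 <= b ->
  (\int[P]_w ((X w) ^+ 2)%:E <= (b ^+ 2)%:E)%E -> sd X <= b.
Proof.
move=> X2 b0 Xb; rewrite -ler_sqr ?nnegrE ?sd_ge0// sqr_sd -lee_fin /cov fineK ?cov_fin//.
apply: le_trans Xb; rewrite -[leLHS]/('V_P[X]%E) varianceE//.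
rewrite {1}expectation.unlock.
apply: (@le_trans _ _ (\int[P]_w ((X w) ^+ 2)%:E - 0)%E); last by rewrite sube0.
by apply: leeB => //; rewrite sqre_ge0.
Qed.

End second_moments.

(** * Parameters of a Gaussian law, and L^2 limits of Gaussian variables *)

Section gaussian_moments.
Context (R : realType).
Local Notation mu := (@lebesgue_measure R).
Implicit Types (m s x z : R).

Lemma normal_pdf_norm m s : normal_pdf m `|s| = normal_pdf m s.
Proof.
apply/funext => x; rewrite /normal_pdf /normal_peak /normal_fun normr_eq0.
by rewrite real_normK ?num_real.
Qed.

Lemma normal_pdf_reflect m s x : s != 0 -> normal_pdf m s (-1 * (x - 2 * m)) = normal_pdf m s x.
Proof.
move=> s0; rewrite normal_pdfE// /normal_fun.
by have -> : (-1 * (x - 2 * m) - m) ^+ 2 = (x - m) ^+ 2 by ring.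
Qed.

Lemma normal_pdf_standardize m s z : s != 0 ->
  normal_pdf m s (s * (z - (- m / s))) * `|s| = normal_pdf 0 1 z.
Proof.
move=> s0; rewrite (normal_pdfE _ s0) (normal_pdfE _ (oner_neq0 _)) mulrAC.
rewrite /normal_fun; congr (_ * expR _); last by field.
rewrite /normal_peak expr1n mul1r -mulrnAr sqrtrM ?sqr_ge0// sqrtr_sqr.
by rewrite invfM mulrAC mulVf ?mul1r// normr_eq0.
Qed.

Definition second_moment_std : \bar R := (\int[mu]_z (z ^+ 2 * normal_pdf 0 1 z)%:E)%E.

Context d (Omega : measurableType d) (P : probability Omega R).
Implicit Types X Y Z : Omega -> R.

Let mpdf m s : measurable_fun setT (EFin \o normal_pdf m s).
Proof. by apply/measurable_EFinP; exact: measurable_normal_pdf. Qed.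

(** The reflection x |-> 2 m - x preserves the normal density and exchanges the positive and
    negative parts of x - m. These have equal integrals, finite because [X] is integrable, so X - m
    has mean 0. *)
Lemma mean_normal X m s : s != 0 -> X \in Lfun P 2%:E ->
  is_density P mu X (EFin \o normal_pdf m s) -> mean P X = m.
Proof.
move=> s0 X2 Xd; have mX := Lfun2_measurable X2.
pose h x : \bar R := (x - m)%:E.
have mh : measurable_fun setT h by apply/measurable_EFinP; exact: measurable_funB.
have X1 : P.-integrable setT (h \o X).
  apply/Lfun1_integrable; apply: Lfun2_Lfun1.
  by rewrite -[X in X \in _]/(X \- cst m); apply: Lfun2B => //; exact: Lfun_cst.
have hh : (\int[P]_w (h^\+ (X w)) = \int[P]_w (h^\- (X w)))%E.
  rewrite !(ge0_integral_density Xd) //; last 2 first.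
    exact: measurable_funeneg.
    exact: measurable_funepos.
  rewrite (@ge0_integral_affine _ _ (-1) (2 * m)) ?oppr_eq0 ?oner_neq0//; last 2 first.
  - by apply: emeasurable_funM => //; exact: measurable_funepos.
  - by move=> x; rewrite mule_ge0 ?lee_fin ?normal_pdf_ge0.
  apply: eq_integral => x _; rewrite normrN normr1 mule1 /= normal_pdf_reflect//.
  rewrite funeposE funenegE /h -EFinN; congr (Order.max _ _ * _)%E; congr EFin.
  by ring.
have h0 : (\int[P]_w (h (X w)) = 0)%E.
  have fin := integrable_neg_fin_num measurableT X1.
  rewrite integralE -[X in (_ - X)%E]fineK//.
  rewrite [X in (X - _)%E](_ : _ = \int[P]_w (h^\+ (X w)))%E; last first.
    by apply: eq_integral => w _; rewrite !funeposE.
  rewrite hh (_ : \int[P]_w (h^\- (X w)) = \int[P]_w ((h \o X)^\- w))%E; last first.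
    by apply: eq_integral => w _; rewrite !funenegE.
  by rewrite -[X in (X - _)%E]fineK// subee.
have : mean P (X \+ cst (- m)) = 0.
  rewrite /mean expectation.unlock; apply/eqP.
  by rewrite -[X in fine X]/(\int[P]_w (h (X w)))%E h0.
by rewrite meanD ?Lfun_cst// mean_cst; lra.
Qed.

(** Substitution x = m + s z reduces the variance to the second moment of the standard normal
    law. *)
Lemma var_normal X m s : s != 0 -> X \in Lfun P 2%:E ->
  is_density P mu X (EFin \o normal_pdf m s) ->
  (cov P X X)%:E = (second_moment_std * (s ^+ 2)%:E)%E.
Proof.
move=> s0 X2 Xd; have mX := Lfun2_measurable X2.
have mE := mean_normal s0 X2 Xd.
have -> : (cov P X X)%:E = (\int[P]_w ((X w - m) ^+ 2)%:E)%E.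
  by rewrite covE// mE.
pose h x : \bar R := ((x - m) ^+ 2)%:E.
have mh : measurable_fun setT h.
  by apply/measurable_EFinP; apply: measurable_funX; exact: measurable_funB.
have h0 x : (0 <= h x)%E by rewrite lee_fin sqr_ge0.
rewrite -[LHS]/(\int[P]_w (h (X w)))%E (ge0_integral_density Xd mh h0).
rewrite (@ge0_integral_affine _ _ s (- m / s))//; last 2 first.
- exact: emeasurable_funM.
- by move=> x; rewrite mule_ge0 ?lee_fin ?normal_pdf_ge0 ?sqr_ge0.
rewrite /second_moment_std -ge0_integralZr//; last 3 first.
- by apply/measurable_EFinP; apply: measurable_funM => //; exact: measurable_normal_pdf.
- by move=> x _; rewrite lee_fin mulr_ge0 ?normal_pdf_ge0 ?sqr_ge0.
- by rewrite lee_fin sqr_ge0.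
apply: eq_integral => z _ /=.
rewrite -!EFinM -mulrA normal_pdf_standardize// [in RHS]mulrAC; congr (_ * _)%:E.
by field.
Qed.

Lemma gaussian_rv_moments X : X \in Lfun P 2%:E -> gaussian_rv P X ->
  exists s, (cov P X X)%:E = (second_moment_std * (s ^+ 2)%:E)%E /\
    (s != 0 -> is_density P mu X (EFin \o normal_pdf (mean P X) s)).
Proof.
move=> X2 [mX [m [s Xms]]]; exists s.
have [s0|s0] := eqVneq s 0.
  (* A point mass at [m]: the variance is 0, and so is the right side whatever the value of
     [second_moment_std], since [mule0] holds even for an infinite factor. *)
  split => //; rewrite s0 expr0n mule0.
  have Pm : P (X @^-1` [set~ m]) = 0%E.
    by rewrite Xms ?s0 ?eqxx ?diracE ?memNset//=; exact: measurableC.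
  have Xm : {ae P, forall w, X w = m}.
    exists (X @^-1` [set~ m]); split => //.
    by rewrite -[X in measurable X]setTI; apply: mX => //; exact: measurableC.
  have Xm0 : (\int[P]_w ((X w - m) ^+ 2)%:E = 0)%E.
    rewrite (@ge0_ae_eq_integral _ _ _ P _ _ (cst 0%E)) ?integral0//.
    - apply/measurable_EFinP; apply: measurable_funX; exact: measurable_funB.
    - by move=> w _; rewrite lee_fin sqr_ge0.
    - by apply: filterS Xm => w -> _; rewrite subrr expr0n.
  have XB2 : X \- cst m \in Lfun P 2%:E by apply: Lfun2B => //; exact: Lfun_cst.
  have sd0 : sd P (X \- cst m) = 0.
    by apply/eqP; rewrite eq_le sd_ge0 sd_le// expr0n Xm0.
  congr EFin; rewrite -[RHS](expr0n _ 2) -sd0 sqr_sd /cov.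
  by rewrite -[X in _ = fine X]/('V_P[(X \- cst m)%R]%E) varianceB_cst_r.
have Xd : is_density P mu X (EFin \o normal_pdf m s).
  split; [exact: mX|exact: mpdf|by move=> x; rewrite lee_fin normal_pdf_ge0|].
  by move=> B mB; rewrite Xms// (negbTE s0).
by split; [exact: var_normal Xd|rewrite (mean_normal s0 X2 Xd)].
Qed.

End gaussian_moments.

Section gaussian_limit.
Context (R : realType) d (Omega : measurableType d) (P : probability Omega R).
Local Notation mu := (@lebesgue_measure R).
Implicit Types X Y Z : Omega -> R.

(* The value of this constant (it is 1) is irrelevant to the argument. *)
Definition sd_std : R := Num.sqrt (fine (second_moment_std R)).

(** A positive variance excludes s = 0. Being finite and equal to [second_moment_std] times s^2, it
    also forces that constant to be finite and positive, and |s| is then the stated quotient. *)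
Lemma gaussian_rv_density X : X \in Lfun P 2%:E -> gaussian_rv P X ->
  0 < sd P X -> 0 < sd_std /\
    is_density P mu X (EFin \o normal_pdf (mean P X) (sd P X / sd_std)).
Proof.
move=> X2 gX sdX; have [s [covX Xd]] := gaussian_rv_moments X2 gX.
have covX0 : 0 < cov P X X by rewrite -sqrtr_gt0.
have s0 : s != 0.
  apply/negP => /eqP s0; move: covX; rewrite s0 expr0n mule0 => -[c0].
  by rewrite c0 ltxx in covX0.
have s2 : 0 < s ^+ 2 by rewrite exprn_even_gt0.
have kfin : second_moment_std R \is a fin_num.
  case: (second_moment_std R) covX => //; first by rewrite gt0_mulye.
  by rewrite gt0_mulNye.
have covE : cov P X X = fine (second_moment_std R) * s ^+ 2.
  by move: covX; rewrite -(fineK kfin) -EFinM => -[].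
have k0 : 0 < sd_std.
  by rewrite sqrtr_gt0; move: covX0; rewrite covE pmulr_lgt0.
split => //; suff -> : sd P X / sd_std = `|s|.
  by rewrite normal_pdf_norm; exact: Xd.
rewrite /sd covE [fine _ * _]mulrC sqrtrM ?sqr_ge0// sqrtr_sqr mulfK//.
by rewrite gt_eqF.
Qed.

(** The L^2 distance bounds the change of mean and of standard deviation. Once the deviations exceed
    [sd P Z / 2], the normal densities converge uniformly. A Lipschitz function changes in
    expectation by at most a multiple of [r k], so no almost surely convergent subsequence is
    extracted. *)
Lemma gaussian_limit (X_ : nat -> Omega -> R) Z (r : nat -> R) :
  (forall k, X_ k \in Lfun P 2%:E) -> (forall k, gaussian_rv P (X_ k)) ->
  Z \in Lfun P 2%:E -> (forall k, 0 < r k) -> r @ \oo --> (0 : R) ->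
  (forall k, \int[P]_w ((X_ k w - Z w) ^+ 2)%:E <= ((r k) ^+ 2)%:E)%E ->
  0 < sd P Z -> 0 < sd_std /\
    is_density P mu Z (EFin \o normal_pdf (mean P Z) (sd P Z / sd_std)).
Proof.
move=> X2 gX Z2 r0 rcvg Xr sdZ.
have XZ2 k : X_ k \- Z \in Lfun P 2%:E by exact: Lfun2B.
have mean_r k : `|mean P (X_ k) - mean P Z| <= r k.
  have -> : mean P (X_ k) - mean P Z = mean P (X_ k \- Z).
    have := meanD (XZ2 k) Z2.
    rewrite (_ : (X_ k \- Z) \+ Z = X_ k) => [->|]; first by rewrite addrK.
    by apply/funext => w /=; rewrite subrK.
  exact: mean_norm_le (XZ2 k) (r0 k) (Xr k).
have sd_r k : `|sd P (X_ k) - sd P Z| <= r k.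
  exact: le_trans (sd_lipschitz (X2 k) Z2) (sd_le (XZ2 k) (ltW (r0 k)) (Xr k)).
have [k0 _ rk0] : \forall k \near \oo, r k < sd P Z / 2.
  by apply: (cvgr_lt _ rcvg); rewrite divr_gt0.
have sdX k : (k0 <= k)%N -> sd P Z / 2 <= sd P (X_ k).
  by move=> /rk0 /= rk; have := sd_r k; rewrite ler_norml => /andP[]; lra.
have sdX0 k : (k0 <= k)%N -> 0 < sd P (X_ k).
  by move=> /sdX; apply: lt_le_trans; rewrite divr_gt0.
have [std0 _] := gaussian_rv_density (X2 k0) (gX k0) (sdX0 _ (leqnn k0)).
split => //.
pose c := sd P Z / 2 / sd_std.
have c0 : 0 < c by rewrite !divr_gt0.
pose K := (1 + sd_std^-1) / c ^+ 2.
have K0 : 0 <= K by rewrite divr_ge0 ?sqr_ge0// addr_ge0// invr_ge0 ltW.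
pose e k := r (k + k0)%N * K.
have pdf_le k u : `|normal_pdf (mean P (X_ (k + k0)%N)) (sd P (X_ (k + k0)%N) / sd_std) u -
    normal_pdf (mean P Z) (sd P Z / sd_std) u| <= e k.
  apply: (le_trans (normal_pdf_lipschitz _ _ _ c0 _ _)).
  - by rewrite ler_pM2r ?invr_gt0// sdX// leq_addl.
  - rewrite ler_pM2r ?invr_gt0//; lra.
  rewrite /e /K mulrA ler_pM2r ?invr_gt0 ?exprn_gt0// mulrDr mulr1.
  rewrite -mulrBl normrM (gtr0_norm (_ : 0 < sd_std^-1)) ?invr_gt0//.
  by apply: lerD => //; rewrite ler_pM2r ?invr_gt0.
have rcvg' : r (k + k0)%N @[k --> \oo] --> (0 : R) by rewrite cvg_shiftn.
apply: (@density_limit _ _ _ _ (fun k => X_ (k + k0)%N) _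
  (fun k => EFin \o normal_pdf (mean P (X_ (k + k0)%N)) (sd P (X_ (k + k0)%N) / sd_std)) _ e).
- by move=> k; have [] := gaussian_rv_density (X2 (k + k0)%N) (gX _) (sdX0 _ (leq_addl k k0)).
- exact: Lfun2_measurable Z2.
- by apply/measurable_EFinP; exact: measurable_normal_pdf.
- by move=> u; rewrite lee_fin normal_pdf_ge0.
- by rewrite integral_normal_pdf ltry.
- move=> k; apply: aeW => u /=; rewrite -EFinD lee_fin.
  by have := pdf_le k u; rewrite ler_norml => /andP[]; lra.
- move=> k; apply: aeW => u /=; rewrite -EFinD lee_fin.
  by have := pdf_le k u; rewrite ler_norml => /andP[]; lra.
- by move=> k; rewrite mulr_ge0// ltW.
- by rewrite -(mul0r K); exact: cvgMr_tmp.
move=> h [L hL] h01.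
pose L' := `|L|; have L0 : 0 <= L' by exact: normr_ge0.
have hle x y : h x <= h y + L' * `|x - y|.
  have := le_trans (ler_norm _) (hL x y).
  have : L * `|x - y| <= L' * `|x - y| by rewrite ler_wpM2r// ler_norm.
  lra.
have mh : measurable_fun setT (EFin \o h).
  apply/measurable_EFinP; apply: continuous_measurable_fun.
  by apply: is_lipschitz_continuous; exists L.
have mhX k : measurable_fun setT (fun w => (h (X_ k w))%:E).
  by apply: (measurableT_comp mh); exact: (@Lfun2_measurable _ _ _ P).
have mhZ : measurable_fun setT (fun w => (h (Z w))%:E).
  by apply: (measurableT_comp mh); exact: (@Lfun2_measurable _ _ _ P).
have h0 x : 0 <= h x by have /andP[] := h01 x.
have mXZ k : measurable_fun setT (fun w => `|X_ k w - Z w|%:E).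
  by apply/measurable_EFinP; apply: measurableT_comp => //; exact: Lfun2_measurable (XZ2 k).
have step X Y k : measurable_fun setT (fun w => (h (X w))%:E) ->
    measurable_fun setT (fun w => (h (Y w))%:E) ->
    (forall w, `|X w - Y w| = `|X_ k w - Z w|) ->
    (\int[P]_w (h (X w))%:E <= \int[P]_w (h (Y w))%:E + (L' * r k)%:E)%E.
  move=> mX mY XY.
  have nk := integral_norm_le (Lfun2_measurable (XZ2 k)) (r0 k) (Xr k).
  apply: (@le_trans _ _ (\int[P]_w ((h (Y w))%:E + L'%:E * `|X_ k w - Z w|%:E))%E).
    apply: ge0_le_integral => //.
    - by move=> w _; rewrite lee_fin.
    - by apply: emeasurable_funD => //; exact: measurable_funeM.
    - by move=> w _; rewrite -EFinM -EFinD lee_fin -XY hle.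
  rewrite ge0_integralD//; last 3 first.
  - by move=> w _; rewrite lee_fin.
  - by move=> w _; rewrite -EFinM lee_fin mulr_ge0.
  - exact: measurable_funeM.
  rewrite leeD2l// ge0_integralZl//.
  by rewrite EFinM lee_wpmul2l ?lee_fin.
apply: (@cvge_le_errors _ _ _ (fun k => L' * r (k + k0)%N)).
- rewrite ge0_fin_numE; last by apply: integral_ge0 => w _; rewrite lee_fin.
  apply: (@le_lt_trans _ _ 1%E); last exact: ltry.
  rewrite -(probability_setT P) -[X in (_ <= X)%E]mul1e -integral_cst//.
  apply: ge0_le_integral => //; first by move=> w _; rewrite lee_fin.
  by move=> w _; rewrite lee_fin; have /andP[] := h01 (Z w).
- by rewrite -(mulr0 L'); exact: cvgMl_tmp.
- by move=> k; apply: step.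
- by move=> k; apply: step => // w; rewrite distrC.
Qed.

End gaussian_limit.

(** * Integrals of a Gaussian process against bounded functions *)

Section tonelli_on.
Context d1 d2 (T1 : measurableType d1) (T2 : measurableType d2) (R : realType).
Context (m1 : {sigma_finite_measure set T1 -> \bar R}).
Context (m2 : {sigma_finite_measure set T2 -> \bar R}).
Context (D : set T2) (mD : measurable D) (F : T1 * T2 -> \bar R).
Hypothesis mF : measurable_fun (setT `*` D) F.
Hypothesis F0 : forall x y, D y -> (0 <= F (x, y))%E.
Local Open Scope ereal_scope.

(** Measurability is assumed only over [D], which is what [L2_process] provides; extension by zero
    reduces to Tonelli on the whole product. *)
Let FD := F \_ (setT `*` D).

Let mFD : measurable_fun setT FD.
Proof. by apply/(measurable_restrictT _ _).1 => //; exact: measurableX. Qed.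

Let FD0 z : 0 <= FD z.
Proof. by rewrite /FD patchE; case: ifPn => // /[!inE]-[_ Dz]; case: z Dz => x y; exact: F0. Qed.

Let FDl x : \int[m2]_y FD (x, y) = \int[m2]_(y in D) F (x, y).
Proof.
rewrite [RHS]integral_mkcond; apply: eq_integral => y _.
by rewrite /FD !patchE in_setX in_setT.
Qed.

Let FDr y : \int[m1]_x FD (x, y) = ((fun y => \int[m1]_x F (x, y)) \_ D) y.
Proof.
rewrite patchE; case: ifPn => Dy.
  by apply: eq_integral => x _; rewrite /FD patchE in_setX in_setT Dy.
rewrite integral0_eq// => x _.
by rewrite /FD patchE in_setX (negbTE Dy) andbF.
Qed.

Lemma measurable_integral_on : measurable_fun setT (fun x => \int[m2]_(y in D) F (x, y)).
Proof.
by under eq_fun do rewrite -FDl; exact: measurable_fun_fubini_tonelli_F.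
Qed.

Lemma tonelli_on :
  \int[m1]_x \int[m2]_(y in D) F (x, y) = \int[m2]_(y in D) \int[m1]_x F (x, y).
Proof.
rewrite [RHS]integral_mkcond.
transitivity (\int[m1]_x \int[m2]_y FD (x, y)).
  by apply: eq_integral => x _; rewrite FDl.
rewrite fubini_tonelli//.
by apply: eq_integral => y _; rewrite -FDr.
Qed.

Lemma measurable_integral_on_r : measurable_fun D (fun y => \int[m1]_x F (x, y)).
Proof.
apply/(measurable_restrictT _ mD).2.
rewrite (_ : _ \_ _ = fun y => \int[m1]_x FD (x, y)); last by apply/funext => y; rewrite FDr.
exact: measurable_fun_fubini_tonelli_G.
Qed.

End tonelli_on.

Section unit_interval.
Context (R : realType).
Local Notation mu := (@lebesgue_measure R).
Local Notation I := (`[0, 1]%classic : set R).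

Let mI : measurable (`[0, 1]%classic : set (measurableTypeR R)). Proof. exact: measurable_itv. Qed.

Let muI : mu I = 1%E.
Proof. by rewrite lebesgue_measure_itv/= lte_fin ltr01 sube0. Qed.

Let integrable_cst_unit (a : R) : mu.-integrable I (EFin \o cst a).
Proof.
apply/integrableP; split; first exact/measurable_EFinP.
by rewrite /= integral_cst// [X in (_ * X)%E]muI mule1 ltry.
Qed.

Lemma integrable_of_sqr (h : R -> R) : measurable_fun I h ->
  (\int[mu]_(y in I) (h y ^+ 2)%:E < +oo)%E ->
  mu.-integrable I (EFin \o h) /\ mu.-integrable I (fun y => (h y ^+ 2)%:E).
Proof.
move=> mh h2.
have mh2 : measurable_fun I (fun y => (h y ^+ 2)%:E).
  by apply/measurable_EFinP; exact: measurable_funX.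
have ih2 : mu.-integrable I (fun y => (h y ^+ 2)%:E).
  by apply/integrableP; split => //; under eq_integral do rewrite gee0_abs ?lee_fin ?sqr_ge0//.
split => //.
have i1 : mu.-integrable I (fun y => 1 + (h y ^+ 2)%:E)%E.
  by apply: integrableD => //; exact: integrable_cst_unit.
apply: le_integrable i1 => //; first exact/measurable_EFinP.
move=> y _ /=; rewrite lee_fin [leRHS]ger0_norm ?addr_ge0 ?sqr_ge0//.
by rewrite -(real_normK (num_real (h y))); have := sqr_ge0 (`|h y| - 1); nra.
Qed.

(** Since [[0, 1]] has mass 1, h - z integrates to 0 and the cross term with [s] disappears. What is
    left beyond s^2 is the variance of [h], independent of [s]. *)
Lemma integral_sqr_centered (h : R -> R) (s : R) : measurable_fun I h ->
  (\int[mu]_(y in I) (h y ^+ 2)%:E < +oo)%E ->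
  let z := \int[mu]_(y in I) h y in
  (\int[mu]_(y in I) ((s + h y - z) ^+ 2)%:E + (z ^+ 2)%:E =
    (s ^+ 2)%:E + \int[mu]_(y in I) (h y ^+ 2)%:E)%E.
Proof.
move=> mh h2 z; have [ih ih2] := integrable_of_sqr mh h2.
have i0 : mu.-integrable I (EFin \o cst ((s - z) ^+ 2)) by exact: integrable_cst_unit.
have i1 : mu.-integrable I (EFin \o (fun y => 2 * (s - z) * h y)).
  have := integrableZl mI (2 * (s - z)) ih.
  by apply: eq_integrable => // y _; rewrite /= -EFinM.
have i2 : mu.-integrable I (EFin \o (fun y => 2 * (s - z) * h y + h y ^+ 2)).
  by have := integrableD mI i1 ih2; apply: eq_integrable.
pose q := \int[mu]_(y in I) (h y ^+ 2).
have -> : (\int[mu]_(y in I) (h y ^+ 2)%:E = q%:E)%E.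
  by rewrite /q /Rintegral fineK//; exact: integrable_fin_num.
have -> : (\int[mu]_(y in I) ((s + h y - z) ^+ 2)%:E =
    ((s - z) ^+ 2 + (2 * (s - z) * z + q))%:E)%E.
  rewrite -RintegralZl// -RintegralD//.
  have -> : (s - z) ^+ 2 = \int[mu]_(y in I) cst ((s - z) ^+ 2) y.
    by rewrite Rintegral_cst// [X in fine X]muI mulr1.
  rewrite -RintegralD// /Rintegral fineK; last first.
    apply: integrable_fin_num => //.
    by have := integrableD mI i0 i2; apply: eq_integrable.
  by apply: eq_integral => y _; congr EFin; rewrite /=; ring.
by rewrite -!EFinD; congr EFin; ring.
Qed.

Lemma sqr_integral_le (h : R -> R) : measurable_fun I h ->
  (((\int[mu]_(y in I) h y) ^+ 2)%:E <= \int[mu]_(y in I) (h y ^+ 2)%:E)%E.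
Proof.
move=> mh; have [h2|] := ltP (\int[mu]_(y in I) (h y ^+ 2)%:E)%E +oo%E; last first.
  by rewrite leye_eq => /eqP ->; rewrite leey.
have := integral_sqr_centered 0 mh h2 => /=.
rewrite expr0n add0e => <-; rewrite leeDr//.
by apply: integral_ge0 => y _; rewrite lee_fin sqr_ge0.
Qed.

Lemma integral_sqr_centered_le (h : R -> R) (s : R) : measurable_fun I h ->
  (\int[mu]_(y in I) (h y ^+ 2)%:E < +oo)%E ->
  let z := \int[mu]_(y in I) h y in
  (\int[mu]_(y in I) ((s + h y - z) ^+ 2)%:E <=
    (s ^+ 2)%:E + \int[mu]_(y in I) (h y ^+ 2)%:E)%E.
Proof.
move=> mh h2; rewrite /= -integral_sqr_centered//.
by rewrite leeDl// lee_fin sqr_ge0.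
Qed.

End unit_interval.

Section gaussian_integral.
Context d (Omega : measurableType d) (R : realType) (P : probability Omega R).
Local Notation mu := (@lebesgue_measure R).
Local Notation I := (`[0, 1]%classic : set R).
Context (phi : Omega -> R -> R).
Hypothesis phi_gaussian : gaussian_process P I phi.
Hypothesis phi_L2 : L2_process P I phi.
Context (f : R -> R) (b : R).
Hypothesis mf : measurable_fun setT f.
Hypothesis fb : forall y, `|f y| <= b.
Context (Z : Omega -> R).
Hypothesis mZ : measurable_fun setT Z.
Hypothesis ZE : {ae P, forall w, Z w = \int[mu]_(y in I) (phi w y * f y)}.

Let mI : measurable (`[0, 1]%classic : set (measurableTypeR R)).
Proof. exact: measurable_itv. Qed.

Let muI : mu I = 1%E.
Proof. by rewrite lebesgue_measure_itv/= lte_fin ltr01 sube0. Qed.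

Let h w y := phi w y * f y.

Let mh : measurable_fun (setT `*` I) (fun z : Omega * measurableTypeR R => h z.1 z.2).
Proof.
apply: measurable_funM; first exact: phi_L2.1.
by apply: measurable_funTS; exact: (measurableT_comp mf measurable_snd).
Qed.

Let measurable_section (g : Omega * measurableTypeR R -> R) w :
  measurable_fun (setT `*` I) g -> measurable_fun I (fun y => g (w, y)).
Proof.
move=> mg; apply: (@measurable_comp _ _ _ _ (Omega * measurableTypeR R)%type _ (setT `*` I)
  g I (pair w)) => //.
- exact: measurableX.
- by move=> _ [y Iy <-].
- by apply: measurable_funTS; exact: pair1_measurable.
Qed.

Let mhw w : measurable_fun I (h w).
Proof. exact: (measurable_section w mh). Qed.

Let energy : \bar R := (\int[P]_w \int[mu]_(y in I) (h w y ^+ 2)%:E)%E.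

Let mh2 : measurable_fun (setT `*` I) (fun z : Omega * measurableTypeR R => (h z.1 z.2 ^+ 2)%:E).
Proof. by apply/measurable_EFinP; exact: measurable_funX. Qed.

Let b0 : 0 <= b. Proof. exact: le_trans (fb 0). Qed.

Let energy_le : (energy <=
  (b ^+ 2)%:E * \int[P]_w \int[mu]_(y in I) (phi w y ^+ 2)%:E)%E.
Proof.
have mphi2 : measurable_fun (setT `*` I)
    (fun z : Omega * measurableTypeR R => (phi z.1 z.2 ^+ 2)%:E).
  by apply/measurable_EFinP; apply: measurable_funX; exact: phi_L2.1.
have mint := measurable_integral_on mu mI mphi2.
rewrite -ge0_integralZl//; last 3 first.
- by apply: mint => x y _; rewrite lee_fin sqr_ge0.
- by move=> w _; apply: integral_ge0 => y _; rewrite lee_fin sqr_ge0.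
- by rewrite lee_fin sqr_ge0.
apply: ge0_le_integral => //.
- by move=> w _; apply: integral_ge0 => y _; rewrite lee_fin sqr_ge0.
- by apply: (measurable_integral_on mu mI mh2) => x y _; rewrite lee_fin sqr_ge0.
- by apply: measurable_funeM; apply: mint => x y _; rewrite lee_fin sqr_ge0.
have mphiw w : measurable_fun I (fun y => (phi w y ^+ 2)%:E).
  apply/measurable_EFinP; apply: measurable_funX.
  exact: (measurable_section w phi_L2.1).
move=> w _; rewrite -ge0_integralZl//; last 3 first.
- exact: mphiw.
- by move=> y _; rewrite lee_fin sqr_ge0.
- by rewrite lee_fin sqr_ge0.
apply: ge0_le_integral => //.
- by move=> y _; rewrite lee_fin sqr_ge0.
- by apply/measurable_EFinP; apply: measurable_funX; exact: mhw.
- by apply: measurable_funeM; exact: mphiw.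
move=> y _; rewrite -EFinM lee_fin /h exprMn mulrC ler_wpM2r ?sqr_ge0//.
by rewrite -(real_normK (num_real (f y))) ler_sqr ?nnegrE.
Qed.

Let energy_w_ge0 w : (0 <= \int[mu]_(y in I) (h w y ^+ 2)%:E)%E.
Proof. by apply: integral_ge0 => y _; rewrite lee_fin sqr_ge0. Qed.

Let energy_ge0 : (0 <= energy)%E.
Proof. exact: integral_ge0. Qed.

Let energy_lty : (energy < +oo)%E.
Proof.
rewrite (le_lt_trans energy_le)// lte_mul_pinfty ?lee_fin ?sqr_ge0//.
exact: phi_L2.2.
Qed.

Let measurable_energy : measurable_fun setT (fun w => \int[mu]_(y in I) (h w y ^+ 2)%:E)%E.
Proof.
by apply: (measurable_integral_on mu mI mh2) => x y _; rewrite lee_fin sqr_ge0.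
Qed.

Let good : {ae P, forall w, (\int[mu]_(y in I) (h w y ^+ 2)%:E < +oo)%E}.
Proof.
have eint : P.-integrable setT (fun w => \int[mu]_(y in I) (h w y ^+ 2)%:E)%E.
  apply/integrableP; split => //.
  under eq_integral do rewrite gee0_abs//.
  exact: energy_lty.
apply: filterS (integrable_ae measurableT eint) => w /(_ Logic.I).
by rewrite ge0_fin_numE.
Qed.

(** A one-point linear combination is Gaussian, in particular measurable. *)
Let mphiy y : I y -> measurable_fun setT (phi ^~ y).
Proof.
move=> Iy; have [+ _] := @phi_gaussian 1 (fun=> y) (fun=> 1) (fun=> Iy).
by under eq_fun do rewrite big_ord1 mul1r.
Qed.

Let mhy y : I y -> measurable_fun setT (h ^~ y).
Proof. by move=> Iy; apply: measurable_funM => //; exact: mphiy. Qed.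

Let Z_energy : (\int[P]_w (Z w ^+ 2)%:E <= energy)%E.
Proof.
apply: ae_ge0_le_integral => //.
- by move=> w _; rewrite lee_fin sqr_ge0.
- by apply/measurable_EFinP; exact: measurable_funX.
- by apply: filterS ZE => w -> _; exact: (sqr_integral_le (mhw w)).
Qed.

Let Z2 : Z \in Lfun P 2%:E.
Proof. by apply/Lfun2P; split => //; exact: le_lt_trans Z_energy energy_lty. Qed.

(** The added 1 gives the contradiction below: if every point failed, averaging over y would yield V
    <= energy. It also keeps V positive when the energy is 0. *)
Let V : R := fine energy + 1.

Let energyE : energy = (fine energy)%:E.
Proof.
by rewrite fineK// ge0_fin_numE.
Qed.

(* Averaging over the new sample point y, the cross term vanishes since h w has
   mean Z w; so some y increases the second moment of the error by at most V. *)
Let sampling_step (S : Omega -> R) : measurable_fun setT S ->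
  (\int[P]_w (S w ^+ 2)%:E < +oo)%E ->
  exists2 y, I y & (\int[P]_w ((S w + h w y - Z w) ^+ 2)%:E <=
    \int[P]_w (S w ^+ 2)%:E + V%:E)%E.
Proof.
move=> mS S2; apply: contrapT => /forall2NP noy.
pose c : \bar R := (\int[P]_w (S w ^+ 2)%:E)%E.
have cfin : c \is a fin_num.
  by rewrite ge0_fin_numE//; apply: integral_ge0 => w _; rewrite lee_fin sqr_ge0.
pose F (z : Omega * measurableTypeR R) : \bar R :=
  ((S z.1 + h z.1 z.2 - Z z.1) ^+ 2)%:E.
have mS2 : measurable_fun setT (fun w => (S w ^+ 2)%:E : \bar R).
  by apply/measurable_EFinP; exact: measurable_funX.
have mF : measurable_fun (setT `*` I) F.
  apply/measurable_EFinP; apply: measurable_funX; apply: measurable_funB; last first.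
    by apply: measurable_funTS; exact: (measurableT_comp mZ measurable_fst).
  apply: measurable_funD => //.
  by apply: measurable_funTS; exact: (measurableT_comp mS measurable_fst).
have F0 w y : I y -> (0 <= F (w, y))%E by rewrite lee_fin sqr_ge0.
have lb : (c + V%:E <= \int[mu]_(y in I) \int[P]_w F (w, y))%E.
  apply: (@le_trans _ _ (\int[mu]_(y in I) (c + V%:E))%E).
    by rewrite integral_cst// [X in (_ * X)%E]muI mule1.
  apply: ge0_le_integral => //.
  - move=> y _; rewrite adde_ge0//; first by apply: integral_ge0 => w _; rewrite lee_fin sqr_ge0.
    by rewrite lee_fin addr_ge0// fine_ge0.
  - exact: measurable_integral_on_r.
  - move=> y Iy; have [//|/negP] := noy y; rewrite -ltNge => /ltW; exact.
have ub : (\int[mu]_(y in I) \int[P]_w F (w, y) <= c + energy)%E.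
  rewrite -tonelli_on// -ge0_integralD//; last first.
    by move=> w _; rewrite lee_fin sqr_ge0.
  apply: ae_ge0_le_integral => //.
  - by move=> w _; apply: integral_ge0 => y Iy; exact: F0.
  - exact: measurable_integral_on.
  - by move=> w _; rewrite adde_ge0 ?lee_fin ?sqr_ge0.
  - exact: emeasurable_funD.
  - apply: filterS2 good ZE => w goodw Zw _; rewrite /F/= Zw.
    exact: (integral_sqr_centered_le (S w) (mhw w)).
have := le_trans lb ub; rewrite energyE -(fineK cfin) -!EFinD lee_fin /V; lra.
Qed.

(** After division by [k], the error of the sample mean has second moment at most V / k. *)
Let sampling k : exists y : nat -> R, (forall i, I (y i)) /\
  (\int[P]_w ((\sum_(i < k) (h w (y i) - Z w)) ^+ 2)%:E <= (k%:R * V)%:E)%E.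
Proof.
elim: k => [|k [y [Iy yk]]].
  exists (fun=> 0); split=> [i|]; first by rewrite /= in_itv/= lexx ler01.
  rewrite mul0r (_ : \int[P]_w _ = 0)%E// integral0_eq// => w _.
  by rewrite big_ord0 expr0n.
have mS : measurable_fun setT (fun w => \sum_(i < k) (h w (y i) - Z w)).
  by apply: measurable_sum => i /=; apply: measurable_funB => //; exact: (mhy (Iy i)).
have [|z Iz zk] := sampling_step mS; first exact: le_lt_trans yk (ltry _).
exists (fun i => if i == k then z else y i); split=> [i|]; first by case: ifP.
under eq_integral => w _.
  rewrite big_ord_recr/= eqxx.
  under eq_bigr => i _ do rewrite ltn_eqF//.
  rewrite addrA; over.
apply: (le_trans zk); rewrite -natr1 mulrDl mul1r (EFinD _ V).
by apply: leeD2r; exact: yk.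
Qed.

Lemma gaussian_integral : Z \in Lfun P 2%:E /\
  (0 < sd P Z -> 0 < sd_std R /\
    is_density P mu Z (EFin \o normal_pdf (mean P Z) (sd P Z / sd_std R))).
Proof.
split => // sdZ.
have V1 : 1 <= V.
  by rewrite lerDr fine_ge0.
have V0 : 0 < V by exact: lt_le_trans V1.
(* With (j+1)^2 points the L^2 error is at most sqrt V / (j+1), an explicit null sequence. *)
have /choice[y yP] := fun j : nat => sampling (j.+1 ^ 2)%N.
pose n j : R := (j.+1 ^ 2)%:R.
have n0 j : 0 < n j by rewrite ltr0n expn_gt0.
pose X_ j w := \sum_(i < j.+1 ^ 2) f (y j i) / n j * phi w (y j i).
have XE j w : X_ j w - Z w = (\sum_(i < j.+1 ^ 2) (h w (y j i) - Z w)) / n j.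
  rewrite sumrB sumr_const card_ord mulrBl; congr (_ - _).
    by rewrite mulr_suml; apply: eq_bigr => i _; rewrite /h; ring.
  by rewrite -mulr_natr mulfK// gt_eqF.
have XZ j : (\int[P]_w ((X_ j w - Z w) ^+ 2)%:E <= ((Num.sqrt V / j.+1%:R) ^+ 2)%:E)%E.
  have [Iy yn] := yP j.
  under eq_integral => w _ do rewrite XE exprMn mulrC EFinM.
  rewrite ge0_integralZl//; last 3 first.
  - apply/measurable_EFinP; apply: measurable_funX; apply: measurable_sum => i /=.
    by apply: measurable_funB => //; exact: (mhy (Iy i)).
  - by move=> w _; rewrite lee_fin sqr_ge0.
  - by rewrite lee_fin sqr_ge0.
  apply: le_trans (lee_wpmul2l _ yn) _; first by rewrite lee_fin sqr_ge0.
  rewrite -EFinM lee_fin expr_div_n sqr_sqrtr ?(ltW V0)// -natrX -/(n j).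
  rewrite le_eqVlt; apply/orP; left; apply/eqP; field.
  by rewrite gt_eqF.
have gX j : gaussian_rv P (X_ j).
  by apply: phi_gaussian => i; exact: (yP j).1.
have X2 j : X_ j \in Lfun P 2%:E.
  rewrite (_ : X_ j = (X_ j \- Z) \+ Z); last by apply/funext => w /=; rewrite subrK.
  apply: Lfun2D => //; apply/Lfun2P; split.
    by apply: measurable_funB => //; exact: (gX j).1.
  exact: le_lt_trans (XZ j) (ltry _).
apply: (@gaussian_limit _ _ _ _ X_ _ (fun j => Num.sqrt V / j.+1%:R)) => //.
- by move=> j; rewrite divr_gt0 ?sqrtr_gt0.
- by rewrite -(mulr0 (Num.sqrt V)); apply: cvgMl_tmp; exact: cvg_harmonic.
Qed.

Lemma gaussian_integral_energy : (\int[P]_w (Z w ^+ 2)%:E <=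
  (b ^+ 2)%:E * \int[P]_w \int[mu]_(y in I) (phi w y ^+ 2)%:E)%E.
Proof. exact: le_trans Z_energy energy_le. Qed.

End gaussian_integral.

(** * Covariance matrices *)

Section hyperplane.
Context (R : realType).

Let measurable_linear n (c : 'I_n -> R) :
  measurable_fun setT (fun v : n.-tuple R => \sum_(i < n) c i * tnth v i).
Proof.
apply: measurable_sum => i /=; apply: measurable_funM => //.
exact: measurable_tnth.
Qed.

Let linear_cons n (c : 'I_n.+1 -> R) (x : R) (v : n.-tuple R) :
  \sum_(i < n.+1) c i * tnth [tuple of x :: v] i =
  c ord0 * x + \sum_(i < n) c (lift ord0 i) * tnth v i.
Proof. by rewrite big_ord_recl tnth0; under eq_bigr do rewrite tnthS. Qed.

Lemma measurable_hyperplane n (c : 'I_n -> R) (b : R) :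
  measurable [set v : n.-tuple R | \sum_(i < n) c i * tnth v i = b].
Proof.
rewrite (_ : [set v | _] = (fun v : n.-tuple R => \sum_(i < n) c i * tnth v i) @^-1` [set b])//.
by rewrite -[X in measurable X]setTI; exact: measurable_linear.
Qed.

(** Slice along the first coordinate. If a later coefficient is nonzero, every slice is a null
    hyperplane by induction. Otherwise the set is a single point times the whole space, and 0 times
    infinity is 0. *)
Lemma lebesgue_tuple_hyperplane n (c : 'I_n -> R) (b : R) : (exists i, c i != 0) ->
  lebesgue_tuple R n [set v | \sum_(i < n) c i * tnth v i = b] = 0%E.
Proof.
elim: n c b => [|n ih] c b [i ci]; first by case: i ci.
rewrite /= /pushforward.
pose H : set (measurableTypeR R * n.-tuple R) :=
  [set z | c ord0 * z.1 + \sum_(i < n) c (lift ord0 i) * tnth z.2 i = b].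
rewrite [X in product_measure1 _ _ X](_ : _ = H); last first.
  by apply/seteqP; split => -[x v]; rewrite /H /preimage /= linear_cons.
have [[j cj]|tail0] := pselect (exists j, c (lift ord0 j) != 0).
  rewrite /product_measure1 integral0_eq// => x _ /=.
  rewrite -[RHS](ih (fun i => c (lift ord0 i)) (b - c ord0 * x)); last by exists j.
  congr (lebesgue_tuple R n _).
  apply/seteqP; split => v; rewrite /xsection /H /= ?inE /=.
    by move=> <-; rewrite addrAC subrr add0r.
  by move=> ->; rewrite addrC subrK.
have c0 : c ord0 != 0.
  case: (unliftP ord0 i) => [j|] ij; last by rewrite -ij.
  by exfalso; apply: tail0; exists j; rewrite -ij.
have -> : H = [set b / c ord0] `*` setT.
  apply/seteqP; split => -[x v]; rewrite /H /= big1 ?addr0.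
  - by move=> <-; split => //; rewrite mulrAC mulfV// mul1r.
  - by move=> j _; have [->|cj] := eqVneq (c (lift ord0 j)) 0; [rewrite mul0r|case: tail0; exists j].
  - by move=> [-> _]; rewrite mulrC divfK.
  - by move=> j _; have [->|cj] := eqVneq (c (lift ord0 j)) 0; [rewrite mul0r|case: tail0; exists j].
rewrite product_measure1E//.
by rewrite [X in (X * _)%E]lebesgue_measure_set1 mul0e.
Qed.

End hyperplane.

Section covariance_matrix.
Context d (Omega : measurableType d) (R : realType) (P : probability Omega R).

Lemma cov0_ae_cst (X : Omega -> R) : X \in Lfun P 2%:E -> cov P X X = 0 ->
  {ae P, forall w, X w = mean P X}.
Proof.
move=> X2 X0; have := covE X2; rewrite X0 => /esym E0.
have mX2 : measurable_fun setT (fun w => ((X w - mean P X) ^+ 2)%:E).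
  apply/measurable_EFinP; apply: measurable_funX; apply: measurable_funB => //.
  exact: Lfun2_measurable X2.
have [+ _] := ae_eq_integral_abs P measurableT mX2.
have -> : (\int[P]_w `|((X w - mean P X) ^+ 2)%:E| = 0)%E.
  by rewrite -[RHS]E0; apply: eq_integral => w _; rewrite gee0_abs// lee_fin sqr_ge0.
move=> /(_ erefl); apply: filterS => w /(_ Logic.I) /= -[] /eqP.
by rewrite sqrf_eq0 subr_eq0 => /eqP.
Qed.

Context n (X : 'I_n -> Omega -> R).
Hypothesis X2 : forall i, X i \in Lfun P 2%:E.
Local Notation S := (covariance_mx P X).

Let cov_lin (c : 'I_n -> R) j :
  cov P (fun w => \sum_(i < n) c i * X i w) (X j) = (\row_i c i *m S) ord0 j.
Proof.
rewrite cov_suml// mxE; apply: eq_bigr => i _.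
by rewrite !mxE.
Qed.

Lemma cov_sum (c : 'I_n -> R) Y : Y \in Lfun P 2%:E ->
  cov P Y (fun w => \sum_(i < n) c i * X i w) = \sum_(i < n) c i * cov P Y (X i).
Proof.
move=> Y2; rewrite covC cov_suml//.
by apply: eq_bigr => i _; rewrite covC.
Qed.

(** A kernel vector gives a linear combination of variance 0, which confines the random vector
    almost surely to a hyperplane, against absolute continuity. This is what makes the bound on the
    inverse usable: [invmx] returns a singular matrix unchanged. *)
Lemma covariance_mx_unit :
  pushforward P (fun w => [tuple X i w | i < n]) `<< lebesgue_tuple R n ->
  S \in unitmx.
Proof.
move=> ac; rewrite unitmxE unitfE; apply/negP => /det0P[v v0 vS].
pose Y w := \sum_(i < n) v ord0 i * X i w.
have Y2 : Y \in Lfun P 2%:E by exact: Lfun2_sum.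
have Y0 : cov P Y Y = 0.
  rewrite cov_sum// big1// => j _; rewrite cov_lin.
  by rewrite (_ : \row_i _ = v) ?vS ?mxE ?mulr0//; apply/rowP => i; rewrite mxE.
have Yae := cov0_ae_cst Y2 Y0.
have [i vi] : exists i, v ord0 i != 0.
  by apply/rV0Pn.
set b := mean P Y in Yae.
pose H := [set t : n.-tuple R | \sum_(i < n) v ord0 i * tnth t i = b].
have H0 : lebesgue_tuple R n H = 0%E by apply: lebesgue_tuple_hyperplane; exists i.
have mH : measurable H by exact: measurable_hyperplane.
have YE w : \sum_(i < n) v ord0 i * tnth [tuple X i w | i < n] i = Y w.
  by apply: eq_bigr => j _; rewrite tnth_mktuple.
have YH : [set w | Y w = b] = (fun w => [tuple X i w | i < n]) @^-1` H.
  by apply/seteqP; split => w; rewrite /H /preimage /= YE.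
have PH : P [set w | Y w = b] = 0%E.
  by rewrite YH; exact: ((null_content_dominatesP _ _).1 ac H mH H0).
have mY : measurable [set w | Y w = b].
  rewrite (_ : mkset _ = Y @^-1` [set b])// -[X in measurable X]setTI.
  exact: (Lfun2_measurable Y2).
have Yn : P.-negligible (~` [set w | Y w = b]) by exact: Yae.
have : P setT = 0%E.
  apply/negligibleP => //.
  apply: (@negligibleS _ _ _ _ (~` [set w | Y w = b] `|` [set w | Y w = b])); last first.
    by apply: negligibleU => //; exact/negligibleP.
  by move=> w _; have [?|?] := pselect (Y w = b); [right|left].
by rewrite probability_setT => /eqP; rewrite onee_eq0.
Qed.

(* Cauchy-Schwarz against W = \sum_i (S^-1)_{0 i} X_i, whose covariance with
   \sum_i c_i X_i is c_0 and whose variance is (S^-1)_{0 0}. *)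
Lemma variance_sum_ge (i0 : 'I_n) (c : 'I_n -> R) : S \in unitmx ->
  c i0 ^+ 2 <= invmx S i0 i0 *
    cov P (fun w => \sum_(i < n) c i * X i w) (fun w => \sum_(i < n) c i * X i w).
Proof.
move=> Su; set Z := fun w => _.
pose W w := \sum_(i < n) invmx S i0 i * X i w.
have Z2 : Z \in Lfun P 2%:E by exact: Lfun2_sum.
have W2 : W \in Lfun P 2%:E by exact: Lfun2_sum.
have WX j : cov P W (X j) = (i0 == j)%:R.
  rewrite cov_lin (_ : \row_i _ = row i0 (invmx S)); last by apply/rowP => i; rewrite !mxE.
  by rewrite -row_mul mulVmx// !mxE.
have WZ : cov P W Z = c i0.
  rewrite cov_sum// (bigD1 i0)//= WX eqxx mulr1 big1 ?addr0// => j ji.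
  by rewrite WX eq_sym (negbTE ji) mulr0.
have WW : cov P W W = invmx S i0 i0.
  rewrite cov_sum// (bigD1 i0)//= WX eqxx mulr1 big1 ?addr0// => j ji.
  by rewrite WX eq_sym (negbTE ji) mulr0.
rewrite -WW -WZ -!sqr_sd -exprMn -(real_normK (num_real (cov P W Z))).
by rewrite ler_sqr ?nnegrE// ?mulr_ge0 ?sd_ge0// cov_le_sd.
Qed.

End covariance_matrix.

(** * The law of the partial sums *)

Section product_sigma_finite.
Context d1 d2 (T1 : measurableType d1) (T2 : measurableType d2) (R : realType).
Context (m1 : {sigma_finite_measure set T1 -> \bar R}).
Context (m2 : {sigma_finite_measure set T2 -> \bar R}).

Lemma sigma_finite_product : sigma_finite setT (m1 \x m2)%E.
Proof.
have /sigma_finiteP[F [TF ndF Foo]] := sigma_finiteT m1.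
have /sigma_finiteP[G [TG ndG Goo]] := sigma_finiteT m2.
exists (fun n => F n `*` G n).
  rewrite -setXTT TF TG; apply/seteqP; split => -[x y] /=; last first.
    by move=> [n _ [? ?]]; split; exists n.
  move=> [[n _ Fx] [k _ Gy]]; exists (maxn n k) => //; split => /=.
    by move: Fx; exact/subsetPset/ndF/leq_maxl.
  by move: Gy; exact/subsetPset/ndG/leq_maxr.
move=> k; have [mF Fk] := Foo k; have [mG Gk] := Goo k.
by split; [exact: measurableX|rewrite product_measure1E// lte_mul_pinfty// ge0_fin_numE].
Qed.

(** Integration over R x (R^n x R) by Tonelli needs the inner product measure as a sigma-finite
    measure in its own right. *)
Definition product_sf : {sigma_finite_measure set (T1 * T2)%type -> \bar R} :=
  HB.pack (m1 \x m2)%E (Measure.class (m1 \x m2 : {measure set (T1 * T2)%type -> \bar R})%E)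
    (Measure_isSigmaFinite.Build _ _ _ _ sigma_finite_product).

End product_sigma_finite.

Section independence.
Context d d1 d2 (Omega : measurableType d) (T1 : measurableType d1) (T2 : measurableType d2).
Context (R : realType) (P : probability Omega R).
Local Open Scope ereal_scope.

(** The joint law agrees with the product of the marginal laws on rectangles, hence on all
    measurable sets; Tonelli does the rest. *)
Lemma independent_rv_integral (X : Omega -> T1) (Y : Omega -> T2) (F : T1 * T2 -> \bar R) :
  measurable_fun setT X -> measurable_fun setT Y -> independent_rv P X Y ->
  measurable_fun setT F -> (forall z, 0 <= F z) ->
  \int[P]_w F (X w, Y w) = \int[P]_w \int[P]_w' F (X w, Y w').
Proof.
move=> mX mY XY mF F0.
pose X' : {RV P >-> T1} := HB.pack X (isMeasurableFun.Build _ _ _ _ _ mX).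
pose Y' : {RV P >-> T2} := HB.pack Y (isMeasurableFun.Build _ _ _ _ _ mY).
have mXY : measurable_fun setT (fun w => (X w, Y w)) by exact: measurable_fun_pair.
pose XY' : {RV P >-> (T1 * T2)%type} :=
  HB.pack (fun w => (X w, Y w)) (isMeasurableFun.Build _ _ _ _ _ mXY).
have prodE A : measurable A ->
    (distribution P X' \x distribution P Y') A = distribution P XY' A.
  by apply: product_measure_unique => A1 A2 mA1 mA2; rewrite -XY.
transitivity (\int[distribution P XY']_z F z).
  by rewrite ge0_integral_distribution.
rewrite (eq_measure_integral (distribution P X' \x distribution P Y')%E); last first.
  by move=> A mA _; exact/esym/prodE.
rewrite fubini_tonelli1// ge0_integral_distribution//; last 2 first.
- exact: measurable_fun_fubini_tonelli_F.
- by move=> a; exact: integral_ge0.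
apply: eq_integral => w _; rewrite /fubini_F/=.
by rewrite ge0_integral_distribution//; exact: measurableT_comp.
Qed.

End independence.

Section lebesgue_tuple_cons.
Context (R : realType) (n : nat).
Local Notation mu := (@lebesgue_measure R).
Local Open Scope ereal_scope.

(** The first coordinate is made innermost because it is the one exchanged for [u] by the affine
    substitution. *)
Lemma integral_lebesgue_tuple_cons (G : n.+1.-tuple R -> \bar R) :
  measurable_fun setT G -> (forall v, 0 <= G v) ->
  \int[lebesgue_tuple R n.+1]_v G v =
  \int[lebesgue_tuple R n]_v \int[mu]_x G [tuple of x :: v].
Proof.
move=> mG G0.
have mc := @measurable_tuple_cons R n.
pose cons_ (z : measurableTypeR R * n.-tuple R) : n.+1.-tuple R := [tuple of z.1 :: z.2].
pose prod : {measure set (measurableTypeR R * n.-tuple R) -> \bar R} :=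
  (mu \x @lebesgue_tuple R n)%E.
pose pf := (pushforward prod cons_ : {measure set (n.+1.-tuple R) -> \bar R}).
rewrite (eq_measure_integral (pf mc)); last by [].
have mGc : measurable_fun setT (G \o cons_) by exact: (measurableT_comp mG mc).
rewrite ge0_integral_pushforward//.
rewrite preimage_setT.
rewrite /prod (@fubini_tonelli1 _ _ _ _ _ mu (lebesgue_tuple R n) _ mGc (fun z => G0 _)).
exact: (@fubini_tonelli _ _ _ _ _ mu (lebesgue_tuple R n) _ mGc (fun z => G0 _)).
Qed.

End lebesgue_tuple_cons.

(** * The explicit density formula for the partial sums *)

Section heat_modes.
Context d (Omega : measurableType d) (R : realType) (P : probability Omega R).
Context (phi : Omega -> R -> R) (alpha2 : Omega -> R) (x t : R).
Implicit Types (n : nat) (a : R).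

(** Indices start at 0: [heat_mode n] is the coefficient of A_(n+1). *)
Definition heat_mode n a : R := heat_decay n.+1 a t * sin (n.+1%:R * pi * x).

Lemma measurable_heat_decay n : measurable_fun setT (fun a => heat_decay n a t).
Proof.
rewrite /heat_decay; apply: (measurableT_comp (@measurable_expR R)).
apply: (measurableT_comp (@oppr_measurable R setT)).
by apply: measurable_funM => //; exact: measurable_funM.
Qed.

Lemma measurable_heat_mode n : measurable_fun setT (heat_mode n).
Proof. by apply: measurable_funM => //; exact: measurable_heat_decay. Qed.

Lemma heat_partialE n w : heat_partial phi alpha2 x t n w =
  \sum_(i < n) heat_mode i (alpha2 w) * fourier_coef phi i.+1 w.
Proof.
rewrite /heat_partial big_add1 big_mkord; apply: eq_bigr => i _.
by rewrite /heat_mode -mulrA mulrC.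
Qed.

Lemma measurable_fourier_coef n : measurable_fun setT (fourier_vec phi n.+1) ->
  measurable_fun setT (fourier_coef phi n.+1).
Proof.
move=> mv; have := measurableT_comp (measurable_tnth (@ord_max n)) mv.
by apply: eq_measurable_fun => w _; rewrite /= tnth_mktuple.
Qed.

Hypothesis malpha : measurable_fun setT alpha2.

Lemma measurable_heat_partial n : measurable_fun setT (fourier_vec phi n) ->
  measurable_fun setT (heat_partial phi alpha2 x t n).
Proof.
move=> mv; rewrite (funext (heat_partialE n)).
apply: measurable_sum => i /=; apply: measurable_funM => //.
  exact: (measurableT_comp (measurable_heat_mode i)).
have := measurableT_comp (measurable_tnth i) mv.
by apply: eq_measurable_fun => w _; rewrite /= tnth_mktuple.
Qed.

Let measurable_superposition n : measurable_fun setT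
  (fun z : R * n.-tuple R => \sum_(i < n) heat_mode i z.1 * tnth z.2 i).
Proof.
apply: measurable_sum => i /=; apply: measurable_funM.
  exact: (measurableT_comp (measurable_heat_mode i)).
exact: (measurableT_comp (measurable_tnth i)).
Qed.

(** Conditioning on [alpha2] takes the form of two separate integrations over [Omega], so no
    conditional expectation appears. *)
Lemma heat_partial_integral n (F : R -> \bar R) :
  measurable_fun setT (fourier_vec phi n) ->
  independent_rv P alpha2 (fourier_vec phi n) ->
  measurable_fun setT F -> (forall u, 0 <= F u)%E ->
  (\int[P]_w F (heat_partial phi alpha2 x t n w) = \int[P]_w \int[P]_w'
    F (\sum_(i < n) heat_mode i (alpha2 w) * fourier_coef phi i.+1 w')%R)%E.
Proof.
move=> mv ind mF F0.
pose G (z : R * n.-tuple R) : \bar R := F (\sum_(i < n) heat_mode i z.1 * tnth z.2 i).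
transitivity (\int[P]_w G (alpha2 w, fourier_vec phi n w))%E.
  apply: eq_integral => w _; rewrite heat_partialE /G/=; congr F.
  by apply: eq_bigr => i _; rewrite tnth_mktuple.
have mG : measurable_fun setT G by exact: (measurableT_comp mF (@measurable_superposition n)).
rewrite (independent_rv_integral malpha mv ind mG (fun z => F0 _)).
apply: eq_integral => w _; apply: eq_integral => w' _; rewrite /G/=; congr F.
by apply: eq_bigr => i _; rewrite tnth_mktuple.
Qed.

Section density_formula.
Context (n : nat) (fA : n.+1.-tuple R -> R) (fa : R -> R).
Hypothesis sinx : 0 < sin (pi * x).
Hypothesis fA_density :
  is_density P (lebesgue_tuple R n.+1) (fourier_vec phi n.+1) (EFin \o fA).
Hypothesis fa_density : is_density P (@lebesgue_measure R) alpha2 (EFin \o fa).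
Hypothesis ind : independent_rv P alpha2 (fourier_vec phi n.+1).
Local Notation mu := (@lebesgue_measure R).
Local Notation R' := (measurableTypeR R).

Let jac a : R := expR (pi ^+ 2 * a * t) / sin (pi * x).

Let rest (v : n.-tuple R) a : R :=
  \sum_(i < n) tnth v i * heat_decay i.+2 a t * sin (i.+2%:R * pi * x).

Let jac_gt0 a : 0 < jac a.
Proof. by rewrite divr_gt0 ?expR_gt0. Qed.

Let fA0 v : 0 <= fA v.
Proof. by have [_ _ + _] := fA_density => /(_ v); rewrite lee_fin. Qed.

Let fa0 a : 0 <= fa a.
Proof. by have [_ _ + _] := fa_density => /(_ a); rewrite lee_fin. Qed.

Let mfA : measurable_fun setT fA.
Proof. by have [_ /measurable_EFinP] := fA_density. Qed.

Let mfa : measurable_fun setT fa.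
Proof. by have [_ /measurable_EFinP] := fa_density. Qed.

Let mjac : measurable_fun setT jac.
Proof.
apply: measurable_funM => //; apply: (measurableT_comp (@measurable_expR R)).
by apply: measurable_funM => //; exact: measurable_funM.
Qed.

Let mrest : measurable_fun setT (fun z : n.-tuple R * R' => rest z.1 z.2).
Proof.
apply: measurable_sum => i /=; apply: measurable_funM => //.
apply: measurable_funM; first exact: (measurableT_comp (measurable_tnth i)).
exact: (measurableT_comp (measurable_heat_decay i.+2)).
Qed.

Let pulled (z : R' * (n.-tuple R * R')) : R :=
  fA [tuple of (jac z.2.2 * (z.1 - rest z.2.1 z.2.2)) :: z.2.1] * jac z.2.2.

Let mpulled : measurable_fun setT pulled.
Proof.
have mj : measurable_fun setT (fun z : R' * (n.-tuple R * R') => jac z.2.2).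
  exact: (measurableT_comp mjac (measurableT_comp measurable_snd measurable_snd)).
have mr : measurable_fun setT (fun z : R' * (n.-tuple R * R') => rest z.2.1 z.2.2).
  exact: (measurableT_comp mrest measurable_snd).
apply: measurable_funM => //; apply: (measurableT_comp mfA); apply: measurable_cons.
  apply: measurable_funM => //; apply: measurable_funB => //.
exact: (measurableT_comp measurable_fst measurable_snd).
Qed.

Let pulled0 z : 0 <= pulled z.
Proof. by rewrite mulr_ge0// ltW. Qed.

Let mfa2 : measurable_fun setT (fun z : R' * (n.-tuple R * R') => fa z.2.2).
Proof. exact: (measurableT_comp mfa (measurableT_comp measurable_snd measurable_snd)). Qed.

Let heat_densityE u : heat_density fA fa x t u =
  (\int[lebesgue_tuple R n \x mu]_z (pulled (u, z) * fa z.2)%:E)%E.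
Proof. by apply: eq_integral => z _; rewrite /pulled mulrAC. Qed.

(* For fixed a and v, the substitution a_1 = jac a * (u - rest v a) solves
   \sum_i heat_mode i a * a_(i+1) = u. *)
Let superpositionE u v a :
  \sum_(i < n.+1) heat_mode i a * tnth [tuple of (jac a * (u - rest v a)) :: v] i = u.
Proof.
rewrite big_ord_recl tnth0.
have -> : \sum_(i < n) heat_mode (lift ord0 i) a *
    tnth [tuple of (jac a * (u - rest v a)) :: v] (lift ord0 i) = rest v a.
  by apply: eq_bigr => i _; rewrite tnthS /heat_mode mulrC mulrA.
rewrite /heat_mode /heat_decay /jac expr1n mul1r mul1r expRN.
have e0 : expR (pi ^+ 2 * a * t) != 0 by rewrite gt_eqF ?expR_gt0.
have s0 : sin (pi * x) != 0 by rewrite gt_eqF.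
by field; rewrite e0 s0.
Qed.

(** With [alpha2] frozen at [a] and the tail [v] fixed, the affine substitution in a_1 turns the
    value of the partial sum into the free variable [u]. Tonelli then moves [u] outermost, where the
    integral over [B] displays the density. *)
Lemma heat_density_is_density :
  is_density P mu (heat_partial phi alpha2 x t n.+1) (heat_density fA fa x t).
Proof.
have mv : measurable_fun setT (fourier_vec phi n.+1) by have [] := fA_density.
have mker : measurable_fun setT
    (fun z : R' * (n.-tuple R * R') => (pulled z * fa z.2.2)%:E : \bar R).
  by apply/measurable_EFinP; exact: measurable_funM.
have ker0 (z : R' * (n.-tuple R * R')) : (0 <= (pulled z * fa z.2.2)%:E)%E.
  by rewrite lee_fin mulr_ge0.
pose mz := product_sf (lebesgue_tuple R n) mu.
have mden : measurable_fun setT (heat_density fA fa x t).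
  rewrite (funext heat_densityE).
  exact: (@measurable_fun_fubini_tonelli_F _ _ _ _ _ mz _ mker ker0).
split => //.
- exact: measurable_heat_partial.
- by move=> u; rewrite heat_densityE; apply: integral_ge0 => z _; exact: ker0.
move=> B mB.
pose ind_ (u : R') : \bar R := (\1_B u)%:E.
have mind : measurable_fun setT ind_ by apply/measurable_EFinP; exact: measurable_indic.
have ind0 u : (0 <= ind_ u)%E by rewrite lee_fin.
pose g (z : R' * (n.-tuple R * R')) : \bar R := (ind_ z.1 * (pulled z)%:E)%E.
have mg : measurable_fun setT g.
  by apply: emeasurable_funM; [exact: (measurableT_comp mind)|exact/measurable_EFinP].
have g0 z : (0 <= g z)%E by rewrite mule_ge0 ?lee_fin.
pose Gu (z : n.-tuple R * R') : \bar R := (\int[mu]_u g (u, z))%E.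
have mGu : measurable_fun setT Gu.
  exact: (@measurable_fun_fubini_tonelli_G _ _ _ _ _ mu _ mg g0).
have Gu0 z : (0 <= Gu z)%E by exact: integral_ge0.
(* By [innerE] below, this is the probability that the partial sum frozen at [a] lies in [B]. *)
pose H (a : R') : \bar R := (\int[lebesgue_tuple R n]_v Gu (v, a))%E.
have mH : measurable_fun setT H.
  exact: (@measurable_fun_fubini_tonelli_G _ _ _ _ _ (lebesgue_tuple R n) _ mGu Gu0).
have H0 a : (0 <= H a)%E by exact: integral_ge0.
have innerE a : (\int[P]_w (ind_ (\sum_(i < n.+1) heat_mode i a * fourier_coef phi i.+1 w)%R) = H a)%E.
  pose h (v : n.+1.-tuple R) : \bar R := ind_ (\sum_(i < n.+1) heat_mode i a * tnth v i).
  have mh : measurable_fun setT h.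
    apply: (measurableT_comp mind); apply: measurable_sum => i /=.
    by apply: measurable_funM => //; exact: measurable_tnth.
  have h0 v : (0 <= h v)%E by rewrite lee_fin.
  transitivity (\int[P]_w h (fourier_vec phi n.+1 w))%E.
    apply: eq_integral => w _; rewrite /h; congr ind_; apply: eq_bigr => i _.
    by rewrite tnth_mktuple.
  have mhfA : measurable_fun setT (fun v => h v * (fA v)%:E)%E.
    by apply: emeasurable_funM => //; exact/measurable_EFinP.
  rewrite (ge0_integral_density fA_density mh h0) integral_lebesgue_tuple_cons//; last first.
    by move=> v; rewrite mule_ge0 ?lee_fin.
  apply: eq_integral => v _.
  rewrite (@ge0_integral_affine _ _ (jac a) (rest v a)) ?gt_eqF//; last 2 first.
  - by apply: (measurableT_comp mhfA); exact: measurable_cons.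
  - by move=> u; rewrite mule_ge0 ?lee_fin.
  apply: eq_integral => u _.
  by rewrite /h superpositionE /g /pulled/= gtr0_norm// -muleA -EFinM.
transitivity (\int[mu]_a (H a * (fa a)%:E))%E.
  rewrite -(ge0_integral_density fa_density mH H0).
  rewrite -(setIT (_ @^-1` _)) -integral_indic//; last first.
    by rewrite -[X in measurable X]setTI; exact: (measurable_heat_partial mv).
  rewrite [LHS](@heat_partial_integral _ ind_)//.
  by apply: eq_integral => w _; exact: innerE.
rewrite [RHS]integral_mkcond epatch_indic.
transitivity (\int[mu]_u \int[mz]_z (g (u, z) * (fa z.2)%:E))%E; last first.
  apply: eq_integral => u _; rewrite /= muleC heat_densityE -ge0_integralZl//; last first.
    exact: (measurableT_comp mker (pair1_measurable u)).
  by apply: eq_integral => z _; rewrite /g/= (EFinM (pulled (u, z))) muleA.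
have mgfa : measurable_fun setT (fun z : R' * (n.-tuple R * R') => g z * (fa z.2.2)%:E)%E.
  by apply: emeasurable_funM => //; exact/measurable_EFinP.
have gfa0 (z : R' * (n.-tuple R * R')) : (0 <= g z * (fa z.2.2)%:E)%E.
  by apply: mule_ge0 => //; rewrite lee_fin.
rewrite [RHS](@fubini_tonelli _ _ _ _ _ mu mz _ mgfa gfa0).
transitivity (\int[mz]_z (Gu z * (fa z.2)%:E))%E; last first.
  apply: eq_integral => z _; rewrite /fubini_G /Gu /= -ge0_integralZr//.
  - exact: (measurableT_comp mg (pair2_measurable z)).
  - by rewrite lee_fin.
have mGfa : measurable_fun setT (fun z : n.-tuple R * R' => Gu z * (fa z.2)%:E)%E.
  apply: emeasurable_funM => //; apply/measurable_EFinP.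
  exact: (measurableT_comp mfa measurable_snd).
have Gfa0 (z : n.-tuple R * R') : (0 <= Gu z * (fa z.2)%:E)%E.
  by apply: mule_ge0 => //; rewrite lee_fin.
rewrite [RHS](@fubini_tonelli1 _ _ _ _ _ (lebesgue_tuple R n) mu _ mGfa Gfa0).
rewrite [RHS](@fubini_tonelli _ _ _ _ _ (lebesgue_tuple R n) mu _ mGfa Gfa0).
apply: eq_integral => a _; rewrite /fubini_G /H /= -ge0_integralZr//.
- exact: (measurableT_comp mGu (pair2_measurable a)).
- by rewrite lee_fin.
Qed.

End density_formula.

End heat_modes.

(** * The Fourier coefficients and pathwise convergence of the series *)

Section fourier_coefficients.
Context d (Omega : measurableType d) (R : realType) (P : probability Omega R).
Local Notation mu := (@lebesgue_measure R).
Local Notation I := (`[0, 1]%classic : set R).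
Context (phi : Omega -> R -> R).
Hypothesis phi_gaussian : gaussian_process P I phi.
Hypothesis phi_L2 : L2_process P I phi.
Hypothesis mcoef : forall k, measurable_fun setT (fourier_coef phi k.+1).

Let mI : measurable (`[0, 1]%classic : set (measurableTypeR R)).
Proof. exact: measurable_itv. Qed.

Let mode k (y : R) : R := 2 * sin (k.+1%:R * pi * y).

Let measurable_mode k : measurable_fun setT (mode k).
Proof.
apply: measurable_funM => //; apply: (measurableT_comp (continuous_measurable_fun (@continuous_sin R))).
exact: measurable_funM.
Qed.

Let mode_le k y : `|mode k y| <= 2.
Proof. by rewrite normrM ger0_norm// ler_piMr// sin_max. Qed.

Lemma L2_process_section w : measurable_fun I (phi w).
Proof.
apply: (@measurable_comp _ _ _ _ (Omega * measurableTypeR R)%type _ (setT `*` I)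
  (fun z : Omega * measurableTypeR R => phi z.1 z.2) I (pair w)) => //.
- exact: measurableX.
- by move=> _ [y Iy <-].
- exact: phi_L2.1.
- by apply: measurable_funTS; exact: pair1_measurable.
Qed.

(** Linearity of the integrals defining the coefficients needs integrable paths, hence the almost
    everywhere identities that follow. *)
Let integrable_section : {ae P, forall w, mu.-integrable I (EFin \o phi w)}.
Proof.
have mphi2 : measurable_fun (setT `*` I)
    (fun z : Omega * measurableTypeR R => (phi z.1 z.2 ^+ 2)%:E).
  by apply/measurable_EFinP; apply: measurable_funX; exact: phi_L2.1.
have e0 w : (0 <= \int[mu]_(y in I) (phi w y ^+ 2)%:E)%E.
  by apply: integral_ge0 => y _; rewrite lee_fin sqr_ge0.
have int2 : P.-integrable setT (fun w => \int[mu]_(y in I) (phi w y ^+ 2)%:E)%E.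
  apply/integrableP; split.
    by apply: (measurable_integral_on mu mI mphi2) => x y _; rewrite lee_fin sqr_ge0.
  by under eq_integral do rewrite gee0_abs//; exact: phi_L2.2.
apply: filterS (integrable_ae measurableT int2) => w /(_ Logic.I).
rewrite ge0_fin_numE// => fin2.
exact: (integrable_of_sqr (L2_process_section w) fin2).1.
Qed.

Let integrable_mul w (f : R -> R) b : mu.-integrable I (EFin \o phi w) ->
  measurable_fun setT f -> (forall y, `|f y| <= b) ->
  mu.-integrable I (EFin \o (fun y => phi w y * f y)).
Proof.
move=> iphi mf fb.
have ib : mu.-integrable I (fun y => b%:E * (phi w y)%:E)%E by exact: integrableZl.
apply: le_integrable ib => //.
  apply/measurable_EFinP; apply: measurable_funM; first exact: L2_process_section.
  exact: measurable_funTS.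
move=> y _ /=; rewrite lee_fin !normrM mulrC ler_wpM2r// (le_trans (fb y))//.
exact: ler_norm.
Qed.

Let fourier_coefE k w : mu.-integrable I (EFin \o phi w) ->
  fourier_coef phi k.+1 w = \int[mu]_(y in I) (phi w y * mode k y).
Proof.
move=> iphi; rewrite /fourier_coef -RintegralZl//; last first.
  apply: (@integrable_mul w _ 1) => //.
    apply: (measurableT_comp (continuous_measurable_fun (@continuous_sin R))).
    exact: measurable_funM.
  by move=> y; exact: sin_max.
by apply: eq_Rintegral => y _; rewrite /mode mulrCA.
Qed.

Let superposition n (c : 'I_n -> R) y := \sum_(i < n) c i * mode i y.

Let measurable_superposition n c : measurable_fun setT (@superposition n c).
Proof. by apply: measurable_sum => i /=; exact: measurable_funM. Qed.

Let superposition_le n c y : `|@superposition n c y| <= \sum_(i < n) `|c i| * 2.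
Proof.
rewrite (le_trans (ler_norm_sum _ _ _))// ler_sum// => i _.
by rewrite normrM ler_wpM2l.
Qed.

Let superpositionE n (c : 'I_n -> R) w : mu.-integrable I (EFin \o phi w) ->
  \sum_(i < n) c i * fourier_coef phi i.+1 w =
  \int[mu]_(y in I) (phi w y * superposition c y).
Proof.
move=> iphi; elim: n c => [|n ih] c.
  rewrite big_ord0 /superposition.
  under eq_Rintegral do rewrite big_ord0 mulr0.
  by rewrite Rintegral_cst// mul0r.
rewrite big_ord_recr/= ih fourier_coefE// -RintegralZl//; last exact: (integrable_mul _ _ (mode_le n)).
rewrite -RintegralD//.
- by apply: eq_Rintegral => y _; rewrite /superposition big_ord_recr/=; ring.
- exact: (integrable_mul _ _ (superposition_le _)).
- have := integrableZl mI (c ord_max) (integrable_mul iphi (measurable_mode n) (mode_le n)).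
  by apply: eq_integrable => // y _; rewrite /= -EFinM.
Qed.

Lemma fourier_coef_Lfun2 k : fourier_coef phi k.+1 \in Lfun P 2%:E.
Proof.
have ae : {ae P, forall w, fourier_coef phi k.+1 w = \int[mu]_(y in I) (phi w y * mode k y)}.
  by apply: filterS integrable_section => w; exact: fourier_coefE.
exact: (gaussian_integral phi_gaussian phi_L2 (measurable_mode k) (mode_le k) (mcoef k) ae).1.
Qed.

Lemma fourier_coef_bounded : exists2 b : R, 0 < b &
  forall k, (\int[P]_w (fourier_coef phi k.+1 w ^+ 2)%:E <= (b ^+ 2)%:E)%E.
Proof.
pose M : \bar R := (\int[P]_w \int[mu]_(y in I) (phi w y ^+ 2)%:E)%E.
have M0 : (0 <= M)%E.
  by apply: integral_ge0 => w _; apply: integral_ge0 => y _; rewrite lee_fin sqr_ge0.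
have Mfin : M \is a fin_num by rewrite ge0_fin_numE//; exact: phi_L2.2.
(* The bound 2 on each |2 sin| gives 4 M, at most the square of 2 (M + 1); the added 1 makes the
   witness positive. *)
exists (2 * (fine M + 1)); first by rewrite mulr_gt0// ltr_wpDl// fine_ge0.
move=> k.
have ae : {ae P, forall w, fourier_coef phi k.+1 w = \int[mu]_(y in I) (phi w y * mode k y)}.
  by apply: filterS integrable_section => w; exact: fourier_coefE.
rewrite (le_trans (gaussian_integral_energy phi_L2 (measurable_mode k) (mode_le k) (mcoef k) ae))//.
rewrite -/M -(fineK Mfin) -EFinM lee_fin exprMn ler_wpM2l//.
by have := fine_ge0 M0; nra.
Qed.

Lemma superposition_density n (c : 'I_n -> R) :
  let S := fun w => \sum_(i < n) c i * fourier_coef phi i.+1 w in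
  0 < sd P S -> 0 < sd_std R /\
    is_density P mu S (EFin \o normal_pdf (mean P S) (sd P S / sd_std R)).
Proof.
move=> S; have mS : measurable_fun setT S.
  by apply: measurable_sum => i /=; exact: measurable_funM.
have ae : {ae P, forall w, S w = \int[mu]_(y in I) (phi w y * superposition c y)}.
  by apply: filterS integrable_section => w; exact: superpositionE.
exact: (gaussian_integral phi_gaussian phi_L2 (measurable_superposition c)
  (superposition_le c) mS ae).2.
Qed.

(** For an integrable path the coefficients are bounded by twice the L^1 norm of the path. As n <=
    n^2, the decay factors are dominated by the powers of some q < 1. *)
Lemma heat_partial_cvg_ae (alpha2 : Omega -> R) x t : 0 < t ->
  {ae P, forall w, 0 < alpha2 w} ->
  {ae P, forall w, cvg (heat_partial phi alpha2 x t N w @[N --> \oo])}.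
Proof.
move=> t0 alpha0; apply: filterS2 alpha0 integrable_section => w a0 iphi.
pose B := 2 * \int[mu]_(y in I) `|phi w y|.
have coef_le k : `|fourier_coef phi k.+1 w| <= B.
  rewrite /fourier_coef normrM ger0_norm// ler_wpM2l//.
  have imul : mu.-integrable I (EFin \o (fun y => phi w y * sin (k.+1%:R * pi * y))).
    apply: (@integrable_mul w _ 1) => //.
      apply: (measurableT_comp (continuous_measurable_fun (@continuous_sin R))).
      exact: measurable_funM.
    by move=> y; exact: sin_max.
  rewrite (le_trans (le_normr_Rintegral mI imul))//.
  apply: le_Rintegral => //; try exact: integrable_norm.
  by move=> y _; rewrite normrM ler_piMr// sin_max.
have B0 : 0 <= B := le_trans (normr_ge0 _) (coef_le 0%N).
pose q := expR (- (pi ^+ 2 * alpha2 w * t)).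
have q0 : 0 <= q by exact: expR_ge0.
have q1 : `|q| < 1.
  rewrite ger0_norm ?expR_ge0// expR_lt1 oppr_lt0 mulr_gt0// mulr_gt0//.
  by rewrite exprn_gt0 ?pi_gt0.
have -> : (fun N => heat_partial phi alpha2 x t N w) =
    series (fun k => fourier_coef phi k.+1 w * heat_decay k.+1 (alpha2 w) t *
      sin (k.+1%:R * pi * x)).
  by apply/funext => N; rewrite /heat_partial /series/= big_add1.
apply: normed_cvg.
apply: (@series_le_cvg _ _ (geometric (B * q) q)) => //.
- by move=> k /=.
- by move=> k; rewrite /geometric/= mulr_ge0 ?exprn_ge0// mulr_ge0.
- move=> k; rewrite /geometric/= -(mulrA B) -exprS -mulrA normrM ler_pM//.
  rewrite normrM -[leRHS]mulr1 ler_pM//; last exact: sin_max.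
  rewrite ger0_norm ?expR_ge0// /heat_decay /q -expRM_natl ler_expR mulrN lerN2.
  rewrite (_ : k.+1%:R ^+ 2 * _ * _ * _ = k.+1%:R ^+ 2 * (pi ^+ 2 * alpha2 w * t)); last by ring.
  apply: ler_wpM2r; last by rewrite -natrX ler_nat expnS expn1 leq_pmulr.
  by rewrite mulr_ge0 ?(ltW t0)// mulr_ge0 ?sqr_ge0// ltW.
exact: is_cvg_geometric_series.
Qed.

End fourier_coefficients.

(** * The density as a mixture of normal densities *)

(** The hypothesis concerns s^2 because the variance of a frozen sum is polynomial in the modes.
    Inverses and square roots are written as real powers, which are measurable. *)
Lemma measurable_normal_pdf_param d (T : measurableType d) (R : realType) (m s u : T -> R) :
  measurable_fun setT m -> measurable_fun setT (fun z => s z ^+ 2) ->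
  measurable_fun setT u -> (forall z, 0 < s z) ->
  measurable_fun setT (fun z => normal_pdf (m z) (s z) (u z)).
Proof.
move=> mm ms mu s0.
have -> : (fun z => normal_pdf (m z) (s z) (u z)) =
    (fun z => (s z ^+ 2 * pi *+ 2) `^ (- 2^-1) *
              expR (- (u z - m z) ^+ 2 * (s z ^+ 2 *+ 2) `^ (-1))).
  apply/funext => z; have v0 : 0 <= s z ^+ 2 *+ 2 by rewrite mulrn_wge0// sqr_ge0.
  have w0 : 0 <= s z ^+ 2 * pi *+ 2 by rewrite mulrn_wge0// mulr_ge0 ?sqr_ge0// pi_ge0.
  by rewrite normal_pdfE ?gt_eqF// powR_inv1// powRN powR12_sqrt.
apply: measurable_funM.
  apply: (measurableT_comp (@measurable_powR R _)).
  under eq_fun do rewrite -mulrnAr.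
  exact: measurable_funM.
apply: (measurableT_comp (@measurable_expR R)); apply: measurable_funM.
  apply: (measurableT_comp (@oppr_measurable R setT)).
  by apply: measurable_funX; exact: measurable_funB.
apply: (measurableT_comp (@measurable_powR R _)).
under eq_fun do rewrite -mulr_natr.
exact: measurable_funM.
Qed.

Section heat_mixture.
Context d (Omega : measurableType d) (R : realType) (P : probability Omega R).
Local Notation mu := (@lebesgue_measure R).
Local Notation R' := (measurableTypeR R).
Local Notation I := (`[0, 1]%classic : set R).
Context (phi : Omega -> R -> R) (alpha2 : Omega -> R) (x t : R).
Hypothesis phi_gaussian : gaussian_process P I phi.
Hypothesis phi_L2 : L2_process P I phi.
Hypothesis mvec : forall n, measurable_fun setT (fourier_vec phi n.+1).
Hypothesis malpha : measurable_fun setT alpha2.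
Hypothesis ind : forall n, independent_rv P alpha2 (fourier_vec phi n.+1).

Let X k := fourier_coef phi k.+1.

Let mX k : measurable_fun setT (X k).
Proof. exact: measurable_fourier_coef. Qed.

Let X2 k : X k \in Lfun P 2%:E.
Proof. exact: (fourier_coef_Lfun2 phi_gaussian phi_L2). Qed.

Definition heat_frozen n a w := \sum_(i < n) heat_mode x t i a * fourier_coef phi i.+1 w.

Let heat_frozen2 n a : heat_frozen n a \in Lfun P 2%:E.
Proof. by apply: (Lfun2_sum _ (X := fun i : 'I_n => X i)). Qed.

Let measurable_mean n : measurable_fun setT (fun a => mean P (heat_frozen n a)).
Proof.
under eq_fun do rewrite (mean_sum _ (X := fun i : 'I_n => X i))//.
by apply: measurable_sum => i /=; apply: measurable_funM => //; exact: measurable_heat_mode.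
Qed.

Let measurable_var n : measurable_fun setT (fun a => sd P (heat_frozen n a) ^+ 2).
Proof.
under eq_fun do rewrite sqr_sd (cov_sum (X := fun i : 'I_n => X i))//.
apply: measurable_sum => i /=; apply: measurable_funM; first exact: measurable_heat_mode.
under eq_fun do rewrite (cov_suml _ (X := fun i : 'I_n => X i))//.
by apply: measurable_sum => j /=; apply: measurable_funM => //; exact: measurable_heat_mode.
Qed.

(** Division by [sd_std] converts a standard deviation into the scale parameter of [normal_pdf]. *)
Definition frozen_pdf n a u :=
  normal_pdf (mean P (heat_frozen n a)) (sd P (heat_frozen n a) / sd_std R) u.

Definition heat_mixture n u : \bar R := (\int[P]_w (frozen_pdf n (alpha2 w) u)%:E)%E.

Section density.
Variable n : nat.
Hypothesis sd0 : forall a, 0 < sd P (heat_frozen n.+1 a).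

Let std0 : 0 < sd_std R.
Proof.
have [] // := superposition_density phi_gaussian phi_L2 mX
  (c := fun i : 'I_n.+1 => heat_mode x t i 0) (sd0 0).
Qed.

Lemma measurable_frozen_pdf :
  measurable_fun setT (fun z : Omega * R' => frozen_pdf n.+1 (alpha2 z.1) z.2).
Proof.
have ma : measurable_fun setT (fun z : Omega * R' => alpha2 z.1).
  exact: (measurableT_comp malpha).
apply: measurable_normal_pdf_param => [|||z]; last by rewrite divr_gt0.
- exact: (measurableT_comp (measurable_mean n.+1) ma).
- under eq_fun do rewrite exprMn.
  by apply: measurable_funM => //; exact: (measurableT_comp (measurable_var n.+1) ma).
- exact: measurable_snd.
Qed.

Lemma heat_mixture_is_density :
  is_density P mu (heat_partial phi alpha2 x t n.+1) (heat_mixture n.+1).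
Proof.
have mpdf : measurable_fun setT
    (fun z : Omega * R' => (frozen_pdf n.+1 (alpha2 z.1) z.2)%:E).
  by apply/measurable_EFinP; exact: measurable_frozen_pdf.
have pdf0 a u : (0 <= (frozen_pdf n.+1 a u)%:E)%E by rewrite lee_fin normal_pdf_ge0.
split.
- exact: measurable_heat_partial.
- have h0 (z : Omega * R') : (0 <= (frozen_pdf n.+1 (alpha2 z.1) z.2)%:E)%E by [].
  exact: (@measurable_fun_fubini_tonelli_G _ _ _ _ _ P _ mpdf h0).
- by move=> u; exact: integral_ge0.
move=> B mB.
have mpdfB : measurable_fun (setT `*` (B : set R'))
    (fun z : Omega * R' => (frozen_pdf n.+1 (alpha2 z.1) z.2)%:E).
  exact: measurable_funTS.
transitivity (\int[P]_w (\1_B (heat_partial phi alpha2 x t n.+1 w))%:E)%E.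
  rewrite -(setIT (_ @^-1` _)) -integral_indic//.
  rewrite -[X in measurable X]setTI.
  by apply: measurable_heat_partial.
rewrite (@heat_partial_integral _ _ _ _ _ _ _ _ malpha n.+1 (fun u => (\1_B u)%:E))//; last first.
- by apply/measurable_EFinP; exact: measurable_indic.
transitivity (\int[P]_w \int[mu]_(u in B) (frozen_pdf n.+1 (alpha2 w) u)%:E)%E; last first.
  exact: (tonelli_on P mu mB mpdfB).
apply: eq_integral => w _.
have [_ [_ _ _ <-//]] := superposition_density phi_gaussian phi_L2 mX
  (c := fun i : 'I_n.+1 => heat_mode x t i (alpha2 w)) (sd0 (alpha2 w)).
rewrite -(setIT (_ @^-1` _)) -integral_indic//.
rewrite -[X in measurable X]setTI; exact: (Lfun2_measurable (heat_frozen2 n.+1 (alpha2 w)) measurableT mB).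
Qed.

End density.
End heat_mixture.

(** * Uniform control of one step of the mixture *)

Section heat_mixture_step.
Context d (Omega : measurableType d) (R : realType) (P : probability Omega R).
Local Notation I := (`[0, 1]%classic : set R).
Context (phi : Omega -> R -> R) (x t C : R).
Hypothesis sinx : 0 < sin (pi * x).
Hypothesis phi_gaussian : gaussian_process P I phi.
Hypothesis phi_L2 : L2_process P I phi.
Hypothesis mvec : forall n, measurable_fun setT (fourier_vec phi n.+1).
Hypothesis A_ac : forall n, pushforward P (fourier_vec phi n.+1) `<< lebesgue_tuple R n.+1.
Hypothesis cov_bound : forall n,
  invmx (covariance_mx P (fun i : 'I_n.+1 => fourier_coef phi i.+1)) ord0 ord0 <= C.

Let X k := fourier_coef phi k.+1.

Let mX k : measurable_fun setT (X k).
Proof. exact: measurable_fourier_coef. Qed.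

Let X2 k : X k \in Lfun P 2%:E.
Proof. exact: (fourier_coef_Lfun2 phi_gaussian phi_L2). Qed.

Local Notation S := (heat_frozen phi x t).

Let S2 n a : S n a \in Lfun P 2%:E.
Proof. by apply: (Lfun2_sum _ (X := fun i : 'I_n => X i)). Qed.

Let mode0_gt0 a : 0 < heat_mode x t 0 a.
Proof. by rewrite /heat_mode mulr_gt0 ?expR_gt0// mul1r. Qed.

Let mode0_le n a : heat_mode x t 0 a ^+ 2 <= C * sd P (S n.+1 a) ^+ 2.
Proof.
have X2' (i : 'I_n.+1) : X i \in Lfun P 2%:E by exact: X2.
rewrite sqr_sd; apply: le_trans (ler_wpM2r (cov_ge0 _ _) (cov_bound n)).
apply: (variance_sum_ge X2' ord0 (fun i => heat_mode x t i a)).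
exact: (covariance_mx_unit X2' (@A_ac n)).
Qed.

(** Positivity comes from 0 < c_1(0)^2 <= C Var S_1(0). *)
Let C_gt0 : 0 < C.
Proof.
have := lt_le_trans (exprn_gt0 2 (mode0_gt0 0)) (mode0_le 0 0).
by have := sqr_ge0 (sd P (S 1 0)); nra.
Qed.

Lemma heat_frozen_sd_ge n a : heat_mode x t 0 a / Num.sqrt C <= sd P (S n.+1 a).
Proof.
rewrite -ler_sqr ?nnegrE ?sd_ge0 ?divr_ge0 ?sqrtr_ge0 ?(ltW (mode0_gt0 a))//.
by rewrite expr_div_n sqr_sqrtr ?(ltW C_gt0)// ler_pdivrMr// mulrC.
Qed.

Lemma heat_frozen_sd_gt0 n a : 0 < sd P (S n.+1 a).
Proof. by apply: lt_le_trans (heat_frozen_sd_ge n a); rewrite divr_gt0 ?sqrtr_gt0. Qed.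

Let std0 : 0 < sd_std R.
Proof.
have [] // := superposition_density phi_gaussian phi_L2 mX
  (c := fun i : 'I_1 => heat_mode x t i 0) (heat_frozen_sd_gt0 0 0).
Qed.

Let step_le n a (c := heat_mode x t n a) (b : R) : 0 < b ->
  (\int[P]_w (X n w ^+ 2)%:E <= (b ^+ 2)%:E)%E ->
  `|mean P (S n a) - mean P (S n.+1 a)| <= `|c| * b /\
  `|sd P (S n a) - sd P (S n.+1 a)| <= `|c| * b.
Proof.
move=> b0 Xb; pose Y w := c * X n w.
have Y2 : Y \in Lfun P 2%:E by exact: Lfun2Z.
have SE : S n.+1 a = S n a \+ Y.
  by apply/funext => w; rewrite /heat_frozen big_ord_recr.
split.
  rewrite SE meanD// opprD addNKr normrN meanZ// normrM ler_wpM2l//.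
  exact: mean_norm_le Xb.
rewrite distrC; apply: le_trans (sd_lipschitz (S2 _ _) (S2 _ _)) _.
rewrite (_ : S n.+1 a \- S n a = Y); last first.
  by apply/funext => w; rewrite SE /= addrAC subrr add0r.
rewrite /sd covZl// covC covZl// mulrA -expr2 sqrtrM ?sqr_ge0// sqrtr_sqr ler_wpM2l//.
by apply: sd_le Xb => //; exact: ltW.
Qed.

Lemma frozen_pdf_step : exists2 K : R, 0 <= K & forall n a u,
  `|frozen_pdf P phi x t n.+1 a u - frozen_pdf P phi x t n.+2 a u| <=
  K * expR (- ((n.+2%:R ^+ 2 - 2) * pi ^+ 2 * a * t)).
Proof.
have [b b0 Xb] := fourier_coef_bounded phi_L2 mX.
have s0 := sinx; have r0 := std0; have C0 := C_gt0.
(* Here [b] bounds the coefficients in L^2, the sum in parentheses collects the changes of mean and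
   of scale, and the rest is c^-2 without its exponential factor. *)
exists (b * (1 + (sd_std R)^-1) * C * sd_std R ^+ 2 / sin (pi * x) ^+ 2).
  by rewrite !mulr_ge0 ?invr_ge0 ?addr_ge0 ?sqr_ge0 ?invr_ge0// ltW.
move=> n a u; set e := expR _.
have [hm hs] := @step_le n.+1 a b b0 (Xb n.+1).
pose c := heat_mode x t 0 a / Num.sqrt C / sd_std R.
have c0 : 0 < c by rewrite divr_gt0// divr_gt0 ?sqrtr_gt0.
have cle k : c <= sd P (S k.+1 a) / sd_std R.
  by rewrite ler_pM2r ?invr_gt0// heat_frozen_sd_ge.
apply: le_trans (normal_pdf_lipschitz _ _ _ c0 (cle n) (cle n.+1)) _.
have le2 : `|heat_mode x t n.+1 a| <= heat_decay n.+2 a t.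
  by rewrite normrM ger0_norm ?expR_ge0// ler_piMr ?expR_ge0// sin_max.
(* The variance bound costs a factor [heat_decay 1 a t ^- 2], whence the [- 2]. *)
have decE : heat_decay n.+2 a t = e * heat_decay 1 a t ^+ 2.
  rewrite /heat_decay /e -expRM_natl -expRD; congr expR; ring.
have d0 : 0 < heat_decay 1 a t by exact: expR_gt0.
rewrite -mulrBl normrM (gtr0_norm (x := (sd_std R)^-1)) ?invr_gt0//.
have -> : b * (1 + (sd_std R)^-1) * C * sd_std R ^+ 2 / sin (pi * x) ^+ 2 * e =
    heat_decay n.+2 a t * b * (1 + (sd_std R)^-1) / c ^+ 2.
  rewrite decE /c !expr_div_n (sqr_sqrtr (ltW C0)) /heat_mode mul1r exprMn.
  by field; rewrite !gt_eqF.
rewrite ler_pM2r ?invr_gt0 ?exprn_gt0//.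
rewrite mulrDr mulr1 lerD//.
  by apply: le_trans hm _; rewrite ler_pM2r.
rewrite ler_pM2r ?invr_gt0//.
by apply: le_trans hs _; rewrite ler_pM2r.
Qed.

End heat_mixture_step.

(** Where the sequence diverges, [lim] is a default value. It agrees almost everywhere with the
    upper limit, which is measurable, and completeness transfers measurability. *)
Lemma measurable_limn_of_complete d (T : measurableType d) (R : realType)
    (m : {measure set T -> \bar R}) (f_ : nat -> T -> R) :
  measure_is_complete m -> (forall n, measurable_fun setT (f_ n)) ->
  {ae m, forall w, cvg (f_ n w @[n --> \oo])} ->
  measurable_fun setT (fun w => lim (f_ n w @[n --> \oo])).
Proof.
move=> cm mf fcvg; apply/measurable_EFinP.
have mg : measurable_fun setT (fun w => limn_esup (fun n => (f_ n w)%:E)).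
  by apply: (measurable_fun_limn_esup (f := fun n w => (f_ n w)%:E)) => n; exact/measurable_EFinP.
apply: (ae_measurable_fun cm _ mg); apply: filterS fcvg => w fw _ /=.
have fE : (f_ n w)%:E @[n --> \oo] --> (lim (f_ n w @[n --> \oo]))%:E.
  by apply: cvg_EFin => //; near=> n.
by rewrite (cvg_limn_einf_sup fE).2.
Unshelve. all: by end_near. Qed.

Lemma integral_le_shift d (T : measurableType d) (R : realType)
    (m : {measure set T -> \bar R}) (f g h : T -> R) :
  measurable_fun setT f -> measurable_fun setT g -> measurable_fun setT h ->
  (forall w, 0 <= f w) -> (forall w, 0 <= g w) -> (forall w, 0 <= h w) ->
  (forall w, f w <= g w + h w) ->
  (\int[m]_w (f w)%:E <= \int[m]_w (g w)%:E + \int[m]_w (h w)%:E)%E.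
Proof.
move=> mf mg mh f0 g0 h0 fgh.
rewrite -ge0_integralD//; try (by move=> w _; rewrite lee_fin); try exact/measurable_EFinP.
apply: ge0_le_integral => //; try (by move=> w _; rewrite ?adde_ge0 ?lee_fin).
- exact/measurable_EFinP.
- by apply: emeasurable_funD; exact/measurable_EFinP.
Qed.

(** Terms before [m] may be infinite, so the real series starts at [m]; the extra shift [j] aligns
    it with the index of the mode added at each step. *)
Lemma cvg_series_fine (R : realType) (N : nat -> \bar R) m :
  (forall n, 0 <= N n)%E -> (\sum_(m <= n <oo) N n < +oo)%E ->
  (forall n, (m <= n)%N -> N n \is a fin_num) /\
  forall j, cvgn (series (fun k => fine (N (k + m + j)%N))).
Proof.
move=> N0 Noo.
have Nfin n : (m <= n)%N -> N n \is a fin_num.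
  move=> mn; rewrite ge0_fin_numE//; apply: le_lt_trans Noo.
  apply: le_trans (nneseries_lim_ge n.+1 _) => //.
  by rewrite big_nat_recr//= leeDr// sume_ge0.
split=> // j; apply: nondecreasing_is_cvgn.
  by apply: nondecreasing_series => i _ _; exact: fine_ge0.
exists (fine (\sum_(m <= n <oo) N n)) => _ [n _ <-].
have S0 : (0 <= \sum_(m <= n <oo) N n)%E by exact: nneseries_ge0.
rewrite -lee_fin fineK ?ge0_fin_numE// /series/= -sumEFin.
rewrite (eq_bigr (fun k => N (k + (m + j))%N)); last first.
  by move=> k _; rewrite -addnA fineK// Nfin// addnC -addnA leq_addr.
apply: le_trans (nneseries_lim_ge (n + (m + j)) _) => //.
have -> : (\sum_(0 <= k < n) N (k + (m + j))%N = \sum_(m + j <= k < n + (m + j)) N k)%E.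
  by rewrite -[X in index_iota X (n + _)]add0n big_addn addnK.
rewrite [leRHS](@big_cat_nat _ _ _ (m + j)) ?leq_addr ?leq_addl//=.
by rewrite leeDr// sume_ge0.
Qed.

Lemma heat_mixture_dist d (Omega : measurableType d) (R : realType) (P : probability Omega R)
    (phi : Omega -> R -> R) (alpha2 : Omega -> R) (x t K : R) n n' (r : R -> R) u :
  0 <= K -> (forall a, 0 <= r a) -> measurable_fun setT r -> measurable_fun setT alpha2 ->
  measurable_fun setT (fun w => frozen_pdf P phi x t n (alpha2 w) u) ->
  measurable_fun setT (fun w => frozen_pdf P phi x t n' (alpha2 w) u) ->
  (forall a, `|frozen_pdf P phi x t n a u - frozen_pdf P phi x t n' a u| <= K * r a) ->
  (heat_mixture P phi alpha2 x t n u <=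
   heat_mixture P phi alpha2 x t n' u + K%:E * 'N[P]_1[(fun w => (r (alpha2 w))%:E)])%E.
Proof.
move=> K0 r0 mr malpha mn mn' nn'.
have mra : measurable_fun setT (fun w => r (alpha2 w)) by exact: measurableT_comp.
rewrite Lnorm1 -ge0_integralZl//; last first.
  by apply/measurable_EFinP; exact: measurableT_comp.
rewrite [X in (_ + X)%E](eq_integral (fun w => (K * r (alpha2 w))%:E)); last first.
  by move=> w _; rewrite /= ger0_norm.
apply: integral_le_shift => //.
- exact: measurable_funM.
- by move=> w; exact: normal_pdf_ge0.
- by move=> w; exact: normal_pdf_ge0.
- by move=> w; rewrite mulr_ge0.
- by move=> w; have := nn' (alpha2 w); rewrite ler_norml lerBlDl => /andP[].
Qed.

Theorem theorem2p7 (R : realType) (d : measure_display)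
  (Omega : measurableType d) (P : probability Omega R)
  (P_complete : measure_is_complete P)
  (x t : R) (hx : 0 < x < 1) (ht : 0 < t)
  (phi : Omega -> R -> R) (alpha2 : {RV P >-> R})
  (phi_gaussian : gaussian_process P `[0, 1]%classic phi)
  (phi_L2 : L2_process P `[0, 1]%classic phi)
  (alpha2_pos : {ae P, forall w, 0 < alpha2 w})
  (alpha2_indep : forall N : nat, (0 < N)%N ->
     independent_rv P alpha2 (fourier_vec phi N))
  (alpha2_ac : distribution P alpha2 `<< lebesgue_measure)
  (A_ac : forall N : nat, (0 < N)%N ->
     pushforward P (fourier_vec phi N) `<< lebesgue_tuple R N)
  (C : R)
  (cov_bound : forall n : nat,
     invmx (covariance_mx P (fun i : 'I_n.+1 => fourier_coef phi i.+1))
       ord0 ord0 <= C)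
  (decay_summable : exists m : nat,
     (\sum_(m <= n <oo)
        'N[P]_1[(fun w =>
          (expR (- ((n%:R ^+ 2 - 2) * pi ^+ 2 * alpha2 w * t)))%R%:E)]
      < +oo)%E)
  (fA : forall N : nat, N.-tuple R -> R) (fa : R -> R)
  (fA_density : forall N : nat, (0 < N)%N ->
     is_density P (lebesgue_tuple R N) (fourier_vec phi N) (EFin \o fA N))
  (fa_density : is_density P lebesgue_measure alpha2 (EFin \o fa)) :
  [/\ forall n : nat,
        is_density P lebesgue_measure (heat_partial phi alpha2 x t n.+1)
          (heat_density (fA n.+1) fa x t),
      {ae P, forall w, cvg (heat_partial phi alpha2 x t N w @[N --> \oo])} &
      exists g : R -> R,
        is_density P lebesgue_measure (heat_sol phi alpha2 x t) (EFin \o g) /\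
        ('N[lebesgue_measure]_+oo
            [(fun u => heat_density (fA n.+1) fa x t u - (g u)%:E)]
          @[n --> \oo] --> 0)%E].
Proof.
have sinx : 0 < sin (pi * x).
  have /andP[x0 x1] := hx; apply: sin_gt0_pi.
  by rewrite mulr_gt0 ?pi_gt0//= gtr_pMr ?pi_gt0.
have malpha : measurable_fun setT (alpha2 : Omega -> R) by exact: measurable_funPT.
have mvec n : measurable_fun setT (fourier_vec phi n.+1) by have [] := fA_density n.+1 isT.
have mcoef n : measurable_fun setT (fourier_coef phi n.+1) by exact: measurable_fourier_coef.
have ind n : independent_rv P alpha2 (fourier_vec phi n.+1) by exact: alpha2_indep.
have dens n : is_density P lebesgue_measure (heat_partial phi alpha2 x t n.+1)
    (heat_density (fA n.+1) fa x t).
  exact: (heat_density_is_density t malpha sinx (fA_density n.+1 isT) fa_density (ind n)).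
have ucvg := heat_partial_cvg_ae phi_L2 x ht alpha2_pos.
split => //.
have ac n : pushforward P (fourier_vec phi n.+1) `<< lebesgue_tuple R n.+1 by exact: A_ac.
have sd0 := heat_frozen_sd_gt0 t sinx phi_gaussian phi_L2 mvec ac cov_bound.
have [K K0 step] := frozen_pdf_step t sinx phi_gaussian phi_L2 mvec ac cov_bound.
have mixdens n := heat_mixture_is_density phi_gaussian phi_L2 mvec malpha ind (sd0 n).
have mfrozen n u : measurable_fun setT (fun w => frozen_pdf P phi x t n.+1 (alpha2 w) u).
  have mpair : measurable_fun setT (fun w : Omega => (w, u) : Omega * measurableTypeR R).
    exact: pair2_measurable.
  exact: (measurableT_comp
    (measurable_frozen_pdf phi_gaussian phi_L2 mvec malpha (sd0 n)) mpair).
have [m decay_m] := decay_summable.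
set N := fun n : nat => 'N[P]_1[(fun w =>
  (expR (- ((n%:R ^+ 2 - 2) * pi ^+ 2 * alpha2 w * t)))%R%:E)]%E in decay_m.
have [Nfin Ncvg] := cvg_series_fine (fun n => Lnorm_ge0 _ _ _ : (0 <= N n)%E) decay_m.
(* Passing from k + m + 1 to k + m + 2 terms adds mode k + m + 2, whose norm is finite since the
   index is at least [m]. *)
pose e k := K * fine (N (k + m + 2)%N).
pose r n (a : R) := expR (- ((n%:R ^+ 2 - 2) * pi ^+ 2 * a * t)).
have r0 n a : 0 <= r n a by exact: expR_ge0.
have mr n : measurable_fun setT (r n).
  apply: (measurableT_comp (@measurable_expR R)).
  apply: (measurableT_comp (@oppr_measurable R setT)).
  by apply: measurable_funM => //; exact: measurable_funM.
have eE k : (e k)%:E = (K%:E * N (k + m).+2)%E.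
  by rewrite /e addn2 EFinM fineK// Nfin// 2?leqW// leq_addl.
have msol : measurable_fun setT (heat_sol phi alpha2 x t).
  apply: (measurable_limn_of_complete P_complete) => // -[|n].
    (* The density hypotheses start at N = 1; the empty partial sum is handled apart. *)
    by rewrite (_ : _ 0%N = cst 0)//; apply/funext => w; rewrite /heat_partial big_geq.
  exact: measurable_heat_partial.
have [g [gdens gcvg]] : exists g : R -> R,
    is_density P lebesgue_measure (heat_sol phi alpha2 x t) (EFin \o g) /\
    ('N[lebesgue_measure]_+oo
      [(fun u => heat_density (fA (k + m).+1) fa x t u - (g u)%:E)] @[k --> \oo] --> 0)%E.
  (* Both are densities of the same partial sum, so the bounds on the mixtures pass to the explicit
     formula outside a null set, which the essential supremum ignores. *)
  have heat_mix n : {ae lebesgue_measure, forall u,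
      heat_density (fA n.+1) fa x t u = heat_mixture P phi alpha2 x t n.+1 u}.
    by apply: filterS (density_ae_unique (dens n) (mixdens n)) => u; exact.
  apply: (@density_uniform_limit _ _ _ P (fun k => heat_partial phi alpha2 x t (k + m).+1) _
    (fun k => heat_density (fA (k + m).+1) fa x t) e) => //.
  - apply: filterS ucvg => w uw.
    have := uw; rewrite /heat_sol -(cvg_shiftn m.+1).
    by under eq_fun do rewrite addnS.
  - move=> k; apply: filterS2 (heat_mix (k + m)%N) (heat_mix (k + m).+1) => u -> ->.
    rewrite eE; apply: (@heat_mixture_dist _ _ _ P phi alpha2 x t K _ _ (r (k + m).+2)) => //.
  - move=> k; apply: filterS2 (heat_mix (k + m)%N) (heat_mix (k + m).+1) => u -> ->.
    rewrite eE; apply: (@heat_mixture_dist _ _ _ P phi alpha2 x t K _ _ (r (k + m).+2)) => // a.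
    by rewrite distrC; exact: step.
  - by move=> k; rewrite mulr_ge0// fine_ge0// Lnorm_ge0.
  - exact: (@is_cvg_seriesZ R (fun k => fine (N (k + m + 2)%N)) K (Ncvg 2%N)).
exists g; split => //.
by rewrite -(cvg_shiftn m).
Qed.
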